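(* Assume that the left boundary kernel $K^L(\cdot;\alpha)$, $\alpha\in\,]0,1[$, satisfies $$\sup_{\alpha\in\,]0,1[}|\mu_{0,L}|(\alpha)<\infty.$$ Then $$\|\tilde F_{nh}-F\|\to0\quad\text{almost completely, as } n\to\infty.$$ Additionally, if $F$ is Lipschitz on $[a,b]$ and $(n/\log\log n)^{1/2}h\to0$, then $\tilde F_{nh}$ has the Chung-Smirnov property, i.e. $$\limsup_{n\to\infty}\,(2n/\log\log n)^{1/2}\,\|\tilde F_{nh}-F\|\le1\quad\text{almost surely}.$$ The same conclusion (the Chung-Smirnov property) holds under the less restrictive condition $(n/\log\log n)^{1/2}h^2\to0$, whenever $K^L$ satisfies $$\alpha\,(1-\mu_{0,L}(\alpha))+\mu_{1,L}(\alpha)=0\quad\text{for all }\alpha\in\,]0,1[$$ and $F'$ is Lipschitz on $[a,b]$.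
   Context: $X_1,\dots,X_n$ are independent copies of an absolutely continuous real random variable with density $f$ and distribution function $F$, where the support of $f$ is the finite interval $[a,b]$. Integrals without limits are over the whole real line, and $\|\cdot\|$ is the supremum norm over $\mathbb{R}$. At the endpoints $a$ and $b$, $F'$ is understood as the one-sided derivative from inside $[a,b]$. A sequence of random variables $Z_n$ converges to $0$ almost completely if $\sum_n P(|Z_n|>\epsilon)<\infty$ for every $\epsilon>0$. $K$ is a kernel on $\mathbb{R}$, i.e. a bounded and symmetric probability density function with support $[-1,1]$, and $\bar K(u)=\int_{-\infty}^u K(v)\,dv$. The bandwidth $h=h_n$ is a sequence of strictly positive real numbers converging to zero as $n\to\infty$, with $0<h\le (b-a)/2$. Left boundary kernel: for each $\alpha\in\,]0,1[$, $K^L(\cdot;\alpha)$ is a real function on $\mathbb{R}$ with support contained in $[-1,\alpha]$ and $|\mu_{0,L}|(\alpha):=\int|K^L(u;\alpha)|\,du<\infty$. For $k\in\{0,1,2,\dots\}$, $\mu_{k,L}(\alpha)=\int u^kK^L(u;\alpha)\,du$. The right boundary kernel is $K^R(u;\alpha)=K^L(-u;\alpha)$. Put $$\bar K^L(u;\alpha)=\int_{-\infty}^uK^L(v;\alpha)\,dv,\qquad \bar K^R(u;\alpha)=1-\int_u^{+\infty}K^R(v;\alpha)\,dv.$$ The boundary modified kernel distribution function estimator is $\tilde F_{nh}(x)=0$ for $x\le a$, $\tilde F_{nh}(x)=1$ for $x\ge b$, and for $a<x<b$, $$\tilde F_{nh}(x)=\frac1n\sum_{i=1}^n\bar K_{x,h}\Big(\frac{x-X_i}{h}\Big),$$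 where $\bar K_{x,h}(u)=\bar K^L(u;(x-a)/h)$ if $a<x<a+h$, $\bar K_{x,h}(u)=\bar K(u)$ if $a+h\le x\le b-h$, and $\bar K_{x,h}(u)=\bar K^R(u;(b-x)/h)$ if $b-h<x<b$. *)

(* Defs.v *)
From HB Require Import structures.
From mathcomp Require Import all_boot all_order all_algebra finmap.
From mathcomp Require Import all_classical all_reals all_analysis measurable_realfun.

Set Implicit Arguments.
Unset Strict Implicit.
Unset Printing Implicit Defensive.

Import Order.TTheory GRing.Theory Num.Theory.
Import numFieldNormedType.Exports.

Local Open Scope classical_set_scope.
Local Open Scope ring_scope.

Section real_functions.
Context {R : realType}.
Implicit Types (g : R -> R) (A : set R) (x : R).

Definition closed_support g : set R := closure [set x | g x != 0].

(* Valued in \bar R, so that an unbounded function has norm +oo. *)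
Definition sup_norm g : \bar R := ereal_sup (range (fun x => `|g x|%:E)).

(* With A := `[a, b], this is the usual derivative at interior points and the
   one-sided derivative from inside at a and b. *)
Definition has_derivative_within A g x (l : R) : Prop :=
  (g y - g x) / (y - x) @[y --> within A x^'] --> l.

End real_functions.

Section probability_notions.
Context {d : measure_display} {T : measurableType d} {R : realType}.
Variable P : probability T R.

Definition mutually_independent (X : nat -> {RV P >-> R}) : Prop :=
  forall (J : {fset nat}) (A : nat -> set R), (forall i, measurable (A i)) ->
    P (\bigcap_(i in [set` J]) X i @^-1` A i) =
    (\prod_(i <- J) P (X i @^-1` A i))%E.

Definition has_density (X : {RV P >-> R}) (f : R -> R) : Prop :=
  [/\ measurable_fun setT f, forall x, 0 <= f x &
      forall A, measurable A ->
        distribution P X A = (\int[lebesgue_measure]_(x in A) (f x)%:E)%E].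

Definition distribution_function (X : {RV P >-> R}) (x : R) : R :=
  fine (cdf X x).

(* The sequences below are indexed by a sample size, which is at least 1. *)
Definition cvg_almost_completely0 (Z : nat -> T -> \bar R) : Prop :=
  (forall n, (0 < n)%N -> measurable_fun setT (Z n)) /\
  forall e : R, 0 < e ->
    (\sum_(1 <= n <oo) P [set w | e%:E < `|Z n w|] < +oo)%E.

Definition Chung_Smirnov (G : nat -> T -> R -> R) (F : R -> R) : Prop :=
  \forall w \ae P,
    (limn_esup (fun n => (Num.sqrt (2 * n%:R / ln (ln n%:R)))%:E *
                         sup_norm (fun x => (G n w x - F x)%R)) <= 1)%E.

End probability_notions.

Section boundary_kernel_estimator.
Context {R : realType}.
Local Notation mu := (@lebesgue_measure R).
Implicit Types (K : R -> R) (KL : R -> R -> R) (alpha u x a b h : R).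

Definition kernel_density K : Prop :=
  [/\ measurable_fun setT K, forall u, 0 <= K u &
      (\int[mu]_u (K u)%:E = 1)%E] /\
  [/\ bounded_fun K, forall u, K (- u) = K u &
      closed_support K = `[-1, 1]%classic].

(* KL alpha u stands for K^L(u; alpha). *)
Definition left_boundary_kernel KL : Prop :=
  forall alpha, 0 < alpha < 1 ->
    closed_support (KL alpha) `<=` `[-1, alpha] /\
    mu.-integrable setT (EFin \o KL alpha).

Definition right_kernel KL alpha u : R := KL alpha (- u).

Definition abs_moment0 KL alpha : \bar R := (\int[mu]_u `|KL alpha u|%:E)%E.

Definition moment KL (k : nat) alpha : R := \int[mu]_u (u ^+ k * KL alpha u).

Definition int_kernel K u : R := \int[mu]_(v in `]-oo, u]) K v.

Definition int_left_kernel KL alpha u : R :=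
  \int[mu]_(v in `]-oo, u]) KL alpha v.

Definition int_right_kernel KL alpha u : R :=
  1 - \int[mu]_(v in `[u, +oo[) right_kernel KL alpha v.

(* Used for a < x < b and 0 < h <= (b - a) / 2 only. *)
Definition modified_int_kernel a b K KL h x u : R :=
  if x < a + h then int_left_kernel KL ((x - a) / h) u
  else if x <= b - h then int_kernel K u
  else int_right_kernel KL ((b - x) / h) u.

(* The sample X_1, ..., X_n is X 0, ..., X (n - 1). *)
Definition boundary_estimator a b K KL h (n : nat) (X : nat -> R) x : R :=
  if x <= a then 0 else if b <= x then 1 else
  n%:R^-1 * \sum_(i < n) modified_int_kernel a b K KL h x ((x - X i) / h).

End boundary_kernel_estimator.

(* Main.v *)
(* In each of the three regions the estimator is [c + int k(v) F_n(x - h v) dv] for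
   a kernel [k], so its error is at most [int |k|] times the error of the empirical
   distribution function [F_n] on [x - h supp k], plus a bias. The bias is bounded by
   the modulus of continuity of [F], or by its Taylor remainder when
   [alpha (1 - mu_0) + mu_1 = 0]; the linear terms of [F] at [a] and [b] then cancel.
   In the interior [int |k| = 1]; near the boundary [int |k|] is only bounded, but
   there [F_n - F] is of smaller order because its variance is small.

   The sharp upper half of the law of the iterated logarithm for [F_n - F] is obtained
   along geometric blocks of sample sizes. For a single event the deviation from the
   mean is controlled simultaneously for all [n <= N] by Ville's inequality applied to
   the exponential supermartingale; the asymptotically sharp constant comes from the
   variance bound [p (1 - p) <= 1/4]. The supremum over [t] is reached from a fixed
   grid of [F]-quantiles by chaining over cells of probability [16 ^- l], down to the
   level where the trivial bound is enough, and Borel-Cantelli concludes. *)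

Require Import Defs.
From mathcomp Require Import all_boot all_order all_algebra finmap.
From mathcomp Require Import all_classical all_reals all_analysis measurable_realfun.
From mathcomp Require Import ring lra.

Set Implicit Arguments.
Unset Strict Implicit.
Unset Printing Implicit Defensive.

Import Order.TTheory GRing.Theory Num.Theory.
Import numFieldNormedType.Exports.

Local Open Scope classical_set_scope.
Local Open Scope ring_scope.

(** A grid fixed in advance costs only a constant factor in the union bound, which keeps the sharp
    constant, but its cells still hold a fixed proportion of the mass. At level [l] a cell deviation
    has standard deviation of order [sqrt B * 4 ^- l], while the threshold shrinks only like
    [2 ^- l]: the surplus [2 ^ l] puts [4 ^ l] in the exponent, which outruns the logarithm of the
    number of cells. The obstacle is that the exponential parameter must stay at most 1, where the
    quadratic bound on the exponential moment is valid. It grows like [8 ^ l * sigma / B], so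
    chaining must stop at [8 ^ l] of order [B / sigma]; a cell then has expected count at most of
    order [sigma], and monotonicity bridges it. Near the ends, [delta] depends only on [e], so the
    strips of width [2 h] eventually lie where [F] is within [delta] of 0 or 1. There [F] is
    expanded at [a] or [b] and not at [x]: its values 0 and 1 are known there, so a boundary kernel
    of total mass different from 1 still yields the right constant term. *)

(** * Exponential bounds and elementary analysis *)

Section real_lemmas.
Context {R : realType}.
Implicit Types x y s p c : R.

(* [(1 + x + x^2/2 + x^3/2) e^-x] is nondecreasing on [0, 2] and
   [(1 + x + x^2/2) e^-x] nonincreasing on [x <= 0]; both are [1] at [0]. *)
Lemma expR_le_quadratic x : `|x| <= 1 ->
  expR x <= 1 + x + x ^+ 2 / 2 * (1 + `|x|).
Proof.
pose g c y := (1 + y + y ^+ 2 / 2 + c * y ^+ 3) * expR (- y).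
have dg c y : is_derive y 1 (g c)
    ((3 * c - 1 / 2 - c * y) * y ^+ 2 * expR (- y)).
  rewrite /g; apply: is_derive_eq.
  by rewrite /GRing.scale/= !expr2 !exprS !expr0; field.
have cg c : continuous (g c).
  by move=> y; apply/differentiable_continuous/derivable1_diffP/ex_derive.
have cg' c u v : {within `[u, v], continuous (g c)}.
  by apply: continuous_subspaceT => y; exact: cg.
have g0 c : g c 0 = 1 by rewrite /g oppr0 expR0 !expr0n/=; ring.
have gle c : 1 <= g c x -> expR x <= 1 + x + x ^+ 2 / 2 + c * x ^+ 3.
  by rewrite /g expRN ler_pdivlMr ?expR_gt0// mul1r.
move=> x1; have [x0|x0] := leP 0 x.
  rewrite ger0_norm// in x1 *.
  have : 1 <= g (1 / 2) x.
    rewrite -[leLHS](g0 (1 / 2)); apply: (@ger0_derive1_ndecr _ (g (1 / 2)) 0 1) => //.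
    move=> y; rewrite in_itv/= => /andP[y0 y1].
    rewrite derive1E derive_val mulr_ge0 ?expR_ge0// mulr_ge0 ?sqr_ge0//; lra.
  move=> /gle/le_trans; apply; rewrite le_eqVlt; apply/orP; left; apply/eqP.
  by rewrite !exprS; field.
rewrite ltr0_norm// in x1 *.
have : 1 <= g 0 x.
  rewrite -[leLHS](g0 0); apply: (@ler0_derive1_nincr _ (g 0) (- 1) 0) => //; last 2 first.
  - lra.
  - exact: ltW.
  move=> y; rewrite in_itv/= => /andP[y0 y1].
  rewrite derive1E derive_val mulr_le0_ge0 ?expR_ge0// mulr_le0_ge0 ?sqr_ge0//; lra.
move=> /gle/le_trans; apply.
have : 0 <= x ^+ 2 by exact: sqr_ge0.
nra.
Qed.

(** The linear terms cancel and [p (1 - p)^2 + (1 - p) p^2 = p (1 - p)], so the quadratic terms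
    carry exactly the variance; [1 + y <= expR y] finishes. The factor [1 + |s|] tends to 1 with
    [s], which keeps the constant sharp. *)
Lemma bernoulli_mgf_le p s : 0 <= p <= 1 -> `|s| <= 1 ->
  p * expR (s * (1 - p)) + (1 - p) * expR (- (s * p)) <=
  expR (p * (1 - p) * s ^+ 2 * (1 + `|s|) / 2).
Proof.
move=> /andP[p0 p1] s1.
have q0 : 0 <= 1 - p by lra.
have q1 : 1 - p <= 1 by lra.
have e1 : `|s * (1 - p)| <= `|s|.
  by rewrite normrM (ger0_norm q0) ler_piMr.
have e2 : `|- (s * p)| <= `|s|.
  by rewrite normrN normrM (ger0_norm p0) ler_piMr.
have h1 := expR_le_quadratic (le_trans e1 s1).
have h2 := expR_le_quadratic (le_trans e2 s1).
apply: le_trans (expR_ge1Dx _).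
have h1' : expR (s * (1 - p)) <= 1 + s * (1 - p) + (s * (1 - p)) ^+ 2 / 2 * (1 + `|s|).
  apply: (le_trans h1); rewrite lerD2l ler_wpM2l ?lerD2l//.
  by rewrite divr_ge0// sqr_ge0.
have h2' : expR (- (s * p)) <= 1 - s * p + (s * p) ^+ 2 / 2 * (1 + `|s|).
  apply: (le_trans h2); rewrite sqrrN lerD2l ler_wpM2l ?lerD2l//.
  by rewrite divr_ge0// sqr_ge0.
have := lerD (ler_wpM2l p0 h1') (ler_wpM2l q0 h2').
move=> /le_trans; apply; rewrite le_eqVlt; apply/orP; left; apply/eqP.
by field.
Qed.

Lemma bernoulli_inequality c n : 1 <= c -> 1 + n%:R * (c - 1) <= c ^+ n.
Proof.
move=> c1; elim: n => [|n ih]; first by rewrite expr0 mul0r addr0.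
rewrite exprS; apply: (@le_trans _ _ (c * (1 + n%:R * (c - 1)))).
  have n0 : 0 <= n%:R :> R by [].
  have : 0 <= n%:R * (c - 1) * (c - 1) by rewrite !mulr_ge0// subr_ge0.
  rewrite -natr1; nra.
by rewrite ler_wpM2l// (le_trans _ c1).
Qed.

Lemma exists_bracket c x : 1 < c -> 1 <= x ->
  exists k : nat, c ^+ k <= x < c ^+ k.+1.
Proof.
move=> c1 x1.
have [N hN] : exists N, x < c ^+ N.
  have [N hN] := ltr_add_invr c1.
  exists (Num.Def.archi_bound (x * N.+1%:R)).
  have c1' : 1 <= c by exact: ltW.
  apply: lt_le_trans (bernoulli_inequality _ c1').
  set M := Num.Def.archi_bound _.
  have hM : x * N.+1%:R < M%:R.
    by rewrite archi_boundP// mulr_ge0// (le_trans _ x1).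
  apply: (@lt_trans _ _ (M%:R * N.+1%:R^-1)); first by rewrite ltr_pdivlMr.
  apply: (@le_lt_trans _ _ (M%:R * (c - 1))); last by rewrite ltrDr.
  by rewrite ler_wpM2l// lerBrDl ltW.
have [|[|m] hm min] := @ex_minnP (fun N => x < c ^+ N); first by exists N.
  by move: hm; rewrite expr0 ltNge x1.
exists m; rewrite hm andbT leNgt; apply/negP => /min.
by rewrite ltnn.
Qed.

Lemma exists_expr_ge c x : 1 < c -> exists k0 : nat, forall k, (k0 <= k)%N -> x <= c ^+ k.
Proof.
move=> c1; have [|k0 /andP[_ h]] := @exists_bracket c (Num.max 1 x) c1.
  by rewrite le_max lexx.
exists k0.+1 => k hk; apply: (@le_trans _ _ (c ^+ k0.+1)).
  by apply: le_trans (ltW h); rewrite le_max lexx orbT.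
by rewrite ler_weXn2l// ltW.
Qed.

Lemma ln_ln_le x : 0 < x -> ln (ln x) <= 2 * Num.sqrt x.
Proof.
move=> x0; have ln_le y : 0 < y -> ln y <= y.
  move=> y0; have := @le_ln1Dx _ (y - 1).
  by rewrite ltrBrDl subrr addrC subrK => /(_ y0)/le_trans; apply; rewrite gerBl.
have : ln x <= 2 * Num.sqrt x.
  have s0 : 0 < Num.sqrt x by rewrite sqrtr_gt0.
  rewrite -{1}(sqr_sqrtr (ltW x0)) expr2 lnM ?posrE//.
  by have := ln_le _ s0; lra.
have [lx|lx] := ltP 0 (ln x); first by move=> /(le_trans (ln_le _ lx)).
by move=> _; rewrite (ln0 lx) mulr_ge0 ?sqrtr_ge0.
Qed.

(** Gives convergence of the series of [k ^ (-(1 + s))] without integrals: after factoring out a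
    power of [k.+1], it is [1 + y <= expR y] combined with [ln (1 - 1/(k + 1)) <= - 1/(k + 1)]. *)
Lemma powR_telescope (k : nat) s : 0 < s -> (0 < k)%N ->
  (k.+1%:R : R) `^ (- (1 + s)) <= s^-1 * (k%:R `^ (- s) - k.+1%:R `^ (- s)).
Proof.
move=> s0 k0.
have kp : 0 < k%:R :> R by rewrite ltr0n.
have Kp : 0 < k.+1%:R :> R by rewrite ltr0n.
rewrite mulrC ler_pdivlMr// lerBrDr.
rewrite /powR !gt_eqF//.
have -> : expR (- s * ln k%:R) =
    expR (- s * ln (k.+1%:R : R)) * expR (s * (ln k.+1%:R - ln k%:R)).
  by rewrite -expRD; congr expR; ring.
have -> : expR (- (1 + s) * ln (k.+1%:R : R)) =
    expR (- s * ln (k.+1%:R : R)) * k.+1%:R^-1.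
  have -> : k.+1%:R^-1 = expR (- ln k.+1%:R) :> R by rewrite expRN lnK.
  by rewrite -expRD; congr expR; ring.
rewrite -mulrA -[X in _ + X]mulr1 -mulrDr ler_wpM2l ?expR_ge0//.
apply: le_trans (expR_ge1Dx _); rewrite addrC lerD2l mulrC ler_wpM2l ?(ltW s0)//.
rewrite -lerN2 opprB -ln_div ?posrE//.
have -> : k%:R / k.+1%:R = 1 + - k.+1%:R^-1 :> R.
  by rewrite -natr1; field; rewrite natr1 gt_eqF.
by rewrite le_ln1Dx// ltrN2 invf_lt1// ltr1n.
Qed.

Lemma nneseries_lty_telescope (u : nat -> \bar R) (g : nat -> R) k0 :
  (forall k, 0 <= u k < +oo)%E -> (forall k, 0 <= g k) ->
  (forall k, (k0 <= k)%N -> (u k <= (g k - g k.+1)%:E)%E) ->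
  (\sum_(0 <= k <oo) u k < +oo)%E.
Proof.
move=> u0 g0 ug.
have uk0 k : (0 <= u k)%E by case/andP: (u0 k).
rewrite (nneseries_split 0 k0); last by move=> k _; exact: uk0.
rewrite add0n lte_add_pinfty//.
  by apply: lte_sum_pinfty => i _; case/andP: (u0 i).
apply: (@le_lt_trans _ _ (g k0)%:E); last by rewrite ltry.
apply: lime_le; first exact: is_cvg_nneseries.
near=> n.
have kn : (k0 <= n)%N by near: n; exact: nbhs_infty_ge.
apply: (@le_trans _ _ (\sum_(k0 <= k < n) (g k - g k.+1))%:E).
  by rewrite -sumEFin big_nat_cond [leRHS]big_nat_cond lee_sum// => k /andP[/andP[/ug]].
rewrite lee_fin; under eq_bigr do rewrite -opprB.
by rewrite sumrN telescope_sumr// opprB gerBl.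
Unshelve. all: by end_near. Qed.

End real_lemmas.

(** * Independence, Ville's inequality and tails of deviations *)

Section independent_sums.
Context {d : measure_display} {T : measurableType d} {R : realType}.
Variables (P : probability T R) (X : nat -> {RV P >-> R}).

(** The form in which independence is consumed: one new coordinate against a product event on its
    predecessors. *)
Lemma mutually_independent_prefix (A : nat -> set R) (B : set R) m :
  mutually_independent X -> (forall i, measurable (A i)) -> measurable B ->
  P ((\bigcap_(i in `I_m) X i @^-1` A i) `&` X m @^-1` B) =
  (P (\bigcap_(i in `I_m) X i @^-1` A i) * P (X m @^-1` B))%E.
Proof.
move=> indep mA mB.
have capE k (C : nat -> set R) : (forall i, measurable (C i)) ->
    P (\bigcap_(i in `I_k) X i @^-1` C i) =
    (\prod_(0 <= i < k) P (X i @^-1` C i))%E.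
  move=> mC; have := indep [fset i in iota 0 k]%fset C mC.
  rewrite (_ : [set` _] = `I_k); last first.
    by apply/seteqP; split => i /=; rewrite !inE mem_iota.
  move=> ->; apply: perm_big; apply: uniq_perm => //; first exact: iota_uniq.
  by move=> i; rewrite !inE /index_iota subn0.
pose A' i := if i == m then B else A i.
have mA' i : measurable (A' i) by rewrite /A'; case: ifP.
have -> : (\bigcap_(i in `I_m) X i @^-1` A i) `&` X m @^-1` B =
    \bigcap_(i in `I_m.+1) X i @^-1` A' i.
  apply/seteqP; split => w /=.
    move=> [h1 h2] i /=; rewrite ltnS leq_eqVlt /A' => /orP[/eqP->|im].
      by rewrite eqxx.
    by rewrite (ltn_eqF im); exact: h1.
  move=> h; split; last by have := h m (ltnSn m); rewrite /A' /= eqxx.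
  by move=> i /= im; have := h i (ltnW im); rewrite /A' /= (ltn_eqF im).
rewrite !capE// big_nat_recr//= /A' eqxx; congr (_ * _)%E.
by rewrite big_nat_cond [RHS]big_nat_cond; apply: eq_bigr => i /andP[/andP[_ /ltn_eqF->]].
Qed.

Lemma measurable_exists_leq (f : nat -> T -> R) N c :
  (forall n, measurable_fun setT (f n)) ->
  measurable [set w | exists2 n, (n <= N)%N & c <= f n w].
Proof.
move=> mf.
rewrite (_ : mkset _ =
    \bigcup_(n in [set n | (n <= N)%N]) f n @^-1` `[c, +oo[); last first.
  apply/seteqP; split => w /= [n nN].
    by move=> h; exists n => //=; rewrite in_itv/= h.
  by rewrite /= in_itv/= andbT => h; exists n.
by apply: bigcup_measurable => n _; rewrite -[X in measurable X]setTI; exact: mf.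
Qed.

Hypothesis X_indep : mutually_independent X.
Variables (A : set R) (p : R).
Hypotheses (mA : measurable A) (pA : forall i, P (X i @^-1` A) = p%:E).

(* Ville's inequality for products of independent two-valued factors; the history
   [B] lets the induction on [N] condition on the first factor. *)
Lemma product_maximal_inequality (Y : R -> R) (y1 y0 : R) (B : nat -> set R) m N (x : R) :
  measurable_fun setT Y -> (forall z, A z -> Y z = y1) ->
  (forall z, ~ A z -> Y z = y0) -> 0 <= y1 -> 0 <= y0 ->
  p * y1 + (1 - p) * y0 <= 1 -> (forall i, measurable (B i)) -> 0 <= x ->
  (P ((\bigcap_(i in `I_m) X i @^-1` B i) `&`
     [set w | exists2 n, (n <= N)%N &
        (1 <= x * \prod_(m <= i < m + n) Y (X i w))%R]) <=
  x%:E * P (\bigcap_(i in `I_m) X i @^-1` B i))%E.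
Proof.
move=> mY Y1 Y0 y10 y00 y_le1.
have mS k M z : measurable [set w | exists2 n, (n <= M)%N &
    (1 <= z * \prod_(k <= i < k + n) Y (X i w))%R].
  apply: (measurable_exists_leq
    (f := fun n w => z * \prod_(k <= i < k + n) Y (X i w))) => n.
  apply: measurable_funM => //; apply: measurable_prod => i _.
  exact: measurableT_comp.
have mH (C : nat -> set R) k : (forall i, measurable (C i)) ->
    measurable (\bigcap_(i in `I_k) X i @^-1` C i).
  by move=> mC; apply: bigcap_measurableType => i _; exact: measurable_funPTI.
elim: N m B x => [|N ih] m B x mB x0.
(* When [1 <= x], bounding the event by its history is enough. Otherwise [n = 0] cannot succeed: the
   event is empty here, and in the inductive case it must use the first factor. *)
- have [x1|x1] := leP 1 x.
    apply: (@le_trans _ _ (P (\bigcap_(i in `I_m) X i @^-1` B i))).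
      by apply: le_measure; rewrite ?inE//; [apply: measurableI => //; exact: mH|exact: mH].
    by rewrite lee_pemull// lee_fin.
  rewrite (_ : _ `&` _ = set0) ?measure0 ?mule_ge0// ?lee_fin//.
  apply/seteqP; split => w //= -[_ [n]]; rewrite leqn0 => /eqP ->.
  by rewrite addn0 big_geq// mulr1 leNgt x1.
- have [x1|x1] := leP 1 x.
    apply: (@le_trans _ _ (P (\bigcap_(i in `I_m) X i @^-1` B i))).
      by apply: le_measure; rewrite ?inE//; [apply: measurableI => //; exact: mH|exact: mH].
    by rewrite lee_pemull// lee_fin.
pose H := \bigcap_(i in `I_m) X i @^-1` B i.
pose B' C i := if i == m then C else B i.
have mB' C : measurable C -> forall i, measurable (B' C i).
  by move=> mC i; rewrite /B'; case: ifP.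
have B'E C : \bigcap_(i in `I_m.+1) X i @^-1` B' C i = H `&` X m @^-1` C.
  apply/seteqP; split => w /=.
    move=> h; split; last by have := h m (ltnSn m); rewrite /B' /= eqxx.
    by move=> i /= im; have := h i (ltnW im); rewrite /B' /= (ltn_eqF im).
  move=> [h1 h2] i /=; rewrite ltnS leq_eqVlt /B' => /orP[/eqP->|im].
    by rewrite eqxx.
  by rewrite (ltn_eqF im); exact: h1.
pose S k M z := [set w | exists2 n, (n <= M)%N &
    (1 <= z * \prod_(k <= i < k + n) Y (X i w))%R].
have mHC C : measurable C -> measurable (H `&` X m @^-1` C).
  by move=> mC; rewrite -B'E; apply: mH; exact: mB'.
(* The value of the first factor is absorbed into [x] and the outcome of [X m] into the history,
   which brings both pieces under the induction hypothesis at [m.+1]. *)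
have sub : H `&` S m N.+1 x `<=`
   (H `&` X m @^-1` A `&` S m.+1 N (x * y1)) `|`
   (H `&` X m @^-1` (~` A) `&` S m.+1 N (x * y0)).
  move=> w [Hw [[|n]]].
    by move=> _; rewrite addn0 big_geq// mulr1 leNgt x1.
  rewrite ltnS => nN; rewrite big_ltn ?addnS ?ltnS ?leq_addr// mulrA -addSn => h.
  have [Aw|Aw] := pselect (A (X m w)); [left|right]; split => //; exists n => //.
    by rewrite -(Y1 _ Aw).
  by rewrite -(Y0 _ Aw).
have pnA : P (X m @^-1` (~` A)) = (1 - p)%:E.
  rewrite preimage_setC probability_setC ?pA//.
  exact: measurable_funPTI.
have st C y : measurable C -> 0 <= y ->
   (P (H `&` X m @^-1` C `&` S m.+1 N (x * y)%R) <=
    (x * y)%:E * (P H * P (X m @^-1` C)))%E.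
  move=> mC yy0; rewrite -B'E.
  apply: le_trans (ih m.+1 (B' C) (x * y) (mB' _ mC) (mulr_ge0 x0 yy0)) _.
  by rewrite B'E mutually_independent_prefix.
(* Averaging the two branches multiplies [x * P H] by the mean [p y1 + (1 - p) y0] of one factor, at
   most 1: the supermartingale property. *)
apply: (@le_trans _ _ ((x * y1)%:E * (P H * p%:E) + (x * y0)%:E * (P H * (1 - p)%:E))%E).
  rewrite -{1}(pA m) -pnA.
  apply: le_trans _ (leeD (st _ _ mA y10) (st _ _ (measurableC mA) y00)).
  have m1 := measurableI _ _ (mHC _ mA) (mS m.+1 N (x * y1)).
  have m2 := measurableI _ _ (mHC _ (measurableC mA)) (mS m.+1 N (x * y0)).
  apply: le_trans _ (measureU2 _ m1 m2).
  apply: le_measure => //; rewrite inE; last exact: measurableU.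
  by apply: measurableI => //; exact: mH.
have PH : P H \is a fin_num by apply: fin_num_measure; exact: mH.
rewrite -/H -(fineK PH) -!EFinM -EFinD lee_fin.
have : 0 <= x * fine (P H) by rewrite mulr_ge0// fine_ge0.
move=> /(fun h => ler_wpM2l h y_le1).
lra.
Qed.

(* With [A = ]-oo, t]] and [p = F t] this is [n (F_n t - F t)]. *)
Definition deviation n w := \sum_(i < n) (\1_A (X i w) - p).

Lemma measurable_deviation n : measurable_fun setT (deviation n).
Proof.
apply: measurable_sum => i; apply: measurable_funB => //.
by apply: (measurableT_comp (f := \1_A : R -> R)) => //; exact: measurable_indic.
Qed.

Lemma event_probability_ge0_le1 : 0 <= p <= 1.
Proof.
rewrite -!lee_fin -(pA 0); apply/andP; split => //.
by apply: probability_le1; exact: measurable_funPTI.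
Qed.

(** The maximal inequality is applied to [expR (s (1_A - p) - g)], of mean at most 1 by
    [bernoulli_mgf_le]. The starting value [expR (N g - u)] compensates the drift: since
    [n g <= N g], a crossing of [u] at any [n <= N] makes the product reach 1. *)
Lemma deviation_tail_one_sided s u N : `|s| <= 1 ->
  (P [set w | exists2 n, (n <= N)%N & (u <= s * deviation n w)%R] <=
  (expR (N%:R * (p * (1 - p) * s ^+ 2 * (1 + `|s|) / 2) - u))%:E)%E.
Proof.
move=> s1; have /andP[p0 p1] := event_probability_ge0_le1.
pose g := p * (1 - p) * s ^+ 2 * (1 + `|s|) / 2.
have g0 : 0 <= g.
  rewrite /g divr_ge0// mulr_ge0 ?addr_ge0// mulr_ge0 ?sqr_ge0//.
  by rewrite mulr_ge0// subr_ge0.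
pose Y z : R := expR (s * (\1_A z - p) - g).
have mY : measurable_fun setT Y.
  apply: measurableT_comp => //; apply: measurable_funB => //.
  apply: measurable_funM => //; apply: measurable_funB => //.
have prodY n w : \prod_(0 <= i < 0 + n) Y (X i w) =
    expR (s * deviation n w - n%:R * g).
  rewrite add0n big_mkord /Y -expR_sum; congr expR.
  rewrite sumrB -mulr_sumr sumr_const card_ord mulr_natl.
  by [].
have Y1 z : A z -> Y z = expR (s * (1 - p) - g).
  by move=> Az; rewrite /Y indicE mem_set.
have Y0 z : ~ A z -> Y z = expR (- (s * p) - g).
  by move=> Az; rewrite /Y indicE memNset//= sub0r mulrN.
have yle : p * expR (s * (1 - p) - g) + (1 - p) * expR (- (s * p) - g) <= 1.
  rewrite !expRD !mulrA -mulrDl expRN ler_pdivrMr ?expR_gt0// mul1r.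
  by apply: bernoulli_mgf_le => //; rewrite p0.
have := @product_maximal_inequality Y _ _ (fun=> setT) 0 N (expR (N%:R * g - u))
  mY Y1 Y0 (expR_ge0 _) (expR_ge0 _) yle (fun=> measurableT) (expR_ge0 _).
rewrite (_ : `I_0 = set0); last by apply/seteqP; split.
rewrite bigcap_set0 setTI probability_setT mule1.
apply: le_trans; apply: le_measure; rewrite ?inE//.
- apply: (measurable_exists_leq (f := fun n w => s * deviation n w)) => n.
  by apply: measurable_funM => //; exact: measurable_deviation.
- apply: (measurable_exists_leq (f := fun n w =>
    expR (N%:R * g - u) * \prod_(0 <= i < 0 + n) Y (X i w))) => n.
  apply: measurable_funM => //; apply: measurable_prod => i _.
  exact: measurableT_comp.
move=> w /= [n nN h]; exists n => //.
rewrite prodY -expRD -[leLHS]expR0 ler_expR.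
have : n%:R * g <= N%:R * g by rewrite ler_wpM2r// ler_nat.
lra.
Qed.

Lemma measurable_deviation_exceeds u N :
  measurable [set w | exists2 n, (n <= N)%N & (u <= `|deviation n w|)%R].
Proof.
apply: measurable_exists_leq => n; apply: measurableT_comp => //.
exact: measurable_deviation.
Qed.

Lemma deviation_tail s u N : 0 <= s <= 1 ->
  (P [set w | exists2 n, (n <= N)%N & (u <= `|deviation n w|)%R] <=
  (2 * expR (N%:R * (p * (1 - p) * s ^+ 2 * (1 + s) / 2) - s * u))%:E)%E.
Proof.
move=> /andP[s0 s1].
have s1' : `|s| <= 1 by rewrite ger0_norm.
have s1'' : `|- s| <= 1 by rewrite normrN.
have h1 := deviation_tail_one_sided (s * u) N s1'.
have h2 := deviation_tail_one_sided (s * u) N s1''.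
rewrite normrN sqrrN in h2; rewrite ger0_norm// in h1 h2.
have mE z : measurable [set w | exists2 n, (n <= N)%N & (s * u <= z * deviation n w)%R].
  apply: measurable_exists_leq => n; apply: measurable_funM => //.
  exact: measurable_deviation.
rewrite mulr_natl mulr2n EFinD.
apply: le_trans _ (leeD h1 h2); apply: le_trans _ (measureU2 _ (mE s) (mE (- s))).
apply: le_measure; rewrite ?inE//.
- exact: measurable_deviation_exceeds.
- exact: measurableU.
move=> w /= [n nN h]; have [d0|d0] := leP 0 (deviation n w); [left|right]; exists n => //.
  by rewrite ger0_norm// in h; rewrite ler_wpM2l.
by rewrite mulNr -mulrN ler_wpM2l// -ltr0_norm.
Qed.

End independent_sums.

(** * Cumulative integrals and the distribution function of a density *)

Section cumulative_integral.
Context {R : realType}.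
Local Notation mu := (@lebesgue_measure R).
Variable k : R -> R.
Hypothesis ik : mu.-integrable setT (EFin \o k).

Lemma int_kernel_unif_continuous e : 0 < e -> exists2 r, 0 < r &
  forall u v, `|v - u| < r -> `|int_kernel k v - int_kernel k u| < e.
Proof.
move=> e0; have [r [r0 hr]] := integral_normr_continuous ik e0.
exists r => //.
have ik' (A : set R) : measurable A -> mu.-integrable A (EFin \o k).
  by move=> mA; exact: integrableS ik.
suff main u v : u <= v -> v - u < r -> `|int_kernel k v - int_kernel k u| < e.
  move=> u v; have [uv|/ltW vu] := leP u v.
    by rewrite ger0_norm ?subr_ge0//; exact: main.
  by rewrite distrC [X in _ -> X < _]distrC ger0_norm ?subr_ge0//; exact: main.
move=> uv uvr; rewrite /int_kernel Rintegral_itvB//; last exact: ik'.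
apply: le_lt_trans (le_normr_Rintegral _ _) (hr _ _ _) => //; first exact: ik'.
have muE : (mu `]u, v]%classic = (v - u)%:E)%E.
  rewrite lebesgue_measure_itv/= lte_fin; case: ltP => // vu.
  by rewrite (le_anti (introT andP (conj uv vu))) subrr.
by rewrite [X in (X < _)%E]muE lte_fin.
Qed.

Lemma int_kernel_continuous : continuous (int_kernel k).
Proof.
move=> x; apply/cvgrPdist_lt => e e0.
have [r r0 hr] := int_kernel_unif_continuous e0.
near=> y; apply: hr.
near: y; exact: cvgr_dist_lt.
Unshelve. all: by end_near. Qed.

End cumulative_integral.

Section density_distribution.
Context {d : measure_display} {T : measurableType d} {R : realType}.
Variables (P : probability T R) (X : {RV P >-> R}) (f : R -> R) (a b : R).
Hypotheses (ab : a < b) (X_density : has_density X f)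
  (f_support : closed_support f = `[a, b]%classic).
Local Notation mu := (@lebesgue_measure R).
Local Notation F := (distribution_function X).

Lemma distribution_functionE x : (F x)%:E = P (X @^-1` `]-oo, x]).
Proof.
by rewrite /distribution_function fineK// fin_num_measure//; exact: measurable_funPTI.
Qed.

Lemma distribution_function_nondecreasing : {homo F : x y / x <= y}.
Proof.
move=> x y xy; rewrite -lee_fin !distribution_functionE.
exact: cdf_nondecreasing.
Qed.

Lemma distribution_function_ge0_le1 x : 0 <= F x <= 1.
Proof.
by rewrite -!lee_fin !distribution_functionE measure_ge0; exact: cdf_le1.
Qed.

Lemma density_integrable : mu.-integrable setT (EFin \o f).
Proof.
case: X_density => mf f0 fE; apply/integrableP; split; first exact/measurable_EFinP.
under eq_integral do rewrite /= ger0_norm//.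
rewrite -fE//; apply: le_lt_trans (ltry 1).
exact: probability_le1.
Qed.

Lemma distribution_function_int_kernel : F =1 int_kernel f.
Proof.
move=> x; case: X_density => mf f0 fE.
by rewrite /distribution_function /cdf fE.
Qed.

Lemma density_outside_support x : ~ (a <= x <= b) -> f x = 0.
Proof.
move=> xab; apply/eqP/negPn/negP => fx0; apply: xab.
have : closed_support f x by exact: subset_closure.
by rewrite f_support /= in_itv.
Qed.

Lemma distribution_function_left x : x <= a -> F x = 0.
Proof.
move=> xa; rewrite distribution_function_int_kernel /int_kernel.
rewrite -Rintegral_itv_bndo_bndc; last first.
  by apply: integrableS density_integrable.
rewrite (@eq_Rintegral _ _ _ _ _ (cst 0)) ?Rintegral_cst// ?mul0r//.
move=> y; rewrite inE/= in_itv/= => yx; apply: density_outside_support.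
by move=> /andP[]; rewrite leNgt (lt_le_trans yx).
Qed.

Lemma distribution_function_right x : b <= x -> F x = 1.
Proof.
move=> bx; case: X_density => mf f0 fE.
have : P (X @^-1` `]x, +oo[) = 0%E.
  have := fE `]x, +oo[%classic; rewrite /distribution /pushforward => ->//.
  rewrite (@eq_integral _ _ _ _ _ (cst 0%E)) ?integral0//.
  move=> y; rewrite inE/= in_itv/= andbT => xy; congr EFin.
  by apply: density_outside_support => /andP[_]; rewrite leNgt (le_lt_trans bx).
move=> h; apply: EFin_inj; rewrite distribution_functionE.
rewrite -[LHS]adde0 -h -measureU//; last 3 first.
- exact: measurable_funPTI.
- exact: measurable_funPTI.
- by rewrite -preimage_setI -subset0 => w /= []; rewrite !in_itv/= andbT leNgt => /negP.
rewrite -preimage_setU (_ : _ `|` _ = setT); last first.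
  by apply/seteqP; split => // y _ /=; rewrite !in_itv/= andbT; have [|] := leP y x; [left|right].
by rewrite preimage_setT; exact: probability_setT.
Qed.

Lemma distribution_function_unif_continuous e : 0 < e -> exists2 r, 0 < r &
  forall u v, `|v - u| < r -> `|F v - F u| < e.
Proof.
move=> /(int_kernel_unif_continuous density_integrable)[r r0 h].
by exists r => // u v; rewrite !distribution_function_int_kernel; exact: h.
Qed.

Lemma distribution_function_continuous : continuous F.
Proof.
rewrite (_ : F = int_kernel f); last exact/funext/distribution_function_int_kernel.
exact: int_kernel_continuous density_integrable.
Qed.

(* The sets [{F < r}] play the role of [{U < r}] for the uniform variable [U = F(X)]. *)
Lemma measurable_distribution_lt r : measurable [set x | F x < r].
Proof.
have mF : measurable_fun setT F.
  exact: nondecreasing_measurable distribution_function_nondecreasing.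
rewrite (_ : [set _ | _] = F @^-1` `]-oo, r[); last first.
  by apply/seteqP; split => x /=; rewrite in_itv.
by rewrite -[X in measurable X]setTI; exact: mF.
Qed.

(** [F(X)] is uniform because [F] is continuous. The upper bound compares with a point [t] where
    [F t = r]; if the probability [Pr] were below [r], a point where [F] equals [(Pr + r) / 2] would
    give a half-line inside [{F < r}] of mass above [Pr]. *)
Lemma probability_distribution_lt r : 0 <= r <= 1 ->
  P (X @^-1` [set x | F x < r]) = r%:E.
Proof.
move=> /andP[r0 r1].
have quantile s : 0 <= s <= 1 -> exists t, F t = s.
  move=> s01; have [||c _ <-] := @IVT _ F a b s (ltW ab); last by exists c.
    by apply: continuous_subspaceT; exact: distribution_function_continuous.
  rewrite (distribution_function_left (lexx a)) (distribution_function_right (lexx b)).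
  by rewrite min_l// max_r.
have mA := measurable_distribution_lt r.
apply/eqP; rewrite eq_le; apply/andP; split.
  have [t tE] : exists t, F t = r by apply: quantile; rewrite r0.
  rewrite -[leRHS](congr1 EFin tE).
  rewrite distribution_functionE; apply: le_measure; rewrite ?inE.
  - exact: measurable_funPTI.
  - exact: measurable_funPTI.
  move=> w /=; rewrite in_itv/=; apply: contraTT; rewrite -!ltNge -leNgt.
  by rewrite -tE => /ltW; exact: distribution_function_nondecreasing.
rewrite leNgt; apply/negP => lt1.
have [Pr PrE] : exists q, P (X @^-1` [set x | F x < r]) = q%:E.
  exists (fine (P (X @^-1` [set x | F x < r]))); rewrite fineK// fin_num_measure//.
  exact: measurable_funPTI.
rewrite PrE lte_fin in lt1.
have Pr0 : 0 <= Pr by rewrite -lee_fin -PrE.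
have [t tE] : exists t, F t = (Pr + r) / 2 by apply: quantile; lra.
have : ((F t)%:E <= P (X @^-1` [set x | (F x < r)%R]))%E.
  rewrite distribution_functionE; apply: le_measure; rewrite ?inE.
  - exact: measurable_funPTI.
  - exact: measurable_funPTI.
  move=> w /=; rewrite in_itv/= => /distribution_function_nondecreasing /le_lt_trans; apply.
  by rewrite tE; lra.
by rewrite PrE lee_fin tE; lra.
Qed.

End density_distribution.

(** * Discretization and chaining along base 16 grids *)

Section discretization.
Context {d : measure_display} {T : measurableType d} {R : realType}.
Variables (P : probability T R) (X : nat -> {RV P >-> R}).

(** Removing the last base 16 digit of [j] passes to the next coarser grid and crosses at most 15
    cells of the finer one, each costing [v]; the factor 16 rounds this count up. *)
Lemma base16_chain (G : R -> R) (v : nat -> R) l0 m j :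
  (forall l i, (l0 <= l <= l0 + m)%N -> (i < 16 ^ l)%N ->
    `|G (i.+1%:R / 16 ^+ l) - G (i%:R / 16 ^+ l)| <= v l) ->
  (j < 16 ^ (l0 + m))%N ->
  `|G (j%:R / 16 ^+ (l0 + m)) - G ((j %/ 16 ^ m)%:R / 16 ^+ l0)| <=
  \sum_(l0 <= l < l0 + m) 16 * v l.+1.
Proof.
elim: m j => [|m ih] j hv jlt.
  by rewrite addn0 expn0 divn1 subrr normr0 big_geq.
rewrite addnS in hv jlt *.
pose q := (j %/ 16)%N.
have qlt : (q < 16 ^ (l0 + m))%N by rewrite ltn_divLR// -expnSr.
have step r : (q * 16 + r <= j)%N ->
    `|G ((q * 16 + r)%:R / 16 ^+ (l0 + m).+1) -
      G ((q * 16)%:R / 16 ^+ (l0 + m).+1)| <= r%:R * v (l0 + m).+1.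
  elim: r => [|r ihr]; first by rewrite addn0 subrr normr0 mul0r.
  rewrite addnS => rj.
  rewrite -(subrKA (G ((q * 16 + r)%:R / 16 ^+ (l0 + m).+1))).
  apply: (le_trans (ler_normD _ _)).
  rewrite -[in leRHS]natr1 mulrDl mul1r [leRHS]addrC lerD ?ihr//; last exact: ltnW.
  apply: hv; first by rewrite leqnn -addnS leq_addr.
  by apply: leq_ltn_trans jlt; exact: ltnW.
have v0 : 0 <= v (l0 + m).+1.
  apply: le_trans (hv (l0 + m).+1 0 _ _); rewrite ?normr_ge0 ?expn_gt0//.
  by rewrite leqnn -addnS leq_addr.
have jE : (q * 16 + j %% 16)%N = j by rewrite -divn_eq.
have := step (j %% 16)%N; rewrite jE => /(_ (leqnn _)) h1.
have qE : (q * 16)%:R / 16 ^+ (l0 + m).+1 = q%:R / 16 ^+ (l0 + m) :> R.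
  by rewrite exprS natrM; field; rewrite expf_neq0.
rewrite qE in h1.
have h2 : `|G (q%:R / 16 ^+ (l0 + m)) - G ((q %/ 16 ^ m)%:R / 16 ^+ l0)| <=
    \sum_(l0 <= l < l0 + m) 16 * v l.+1.
  apply: ih => // l i /andP[l1 l2]; apply: hv; rewrite l1/=.
  exact: leq_trans l2 (leqnSn _).
rewrite expnS divnMA -/q -(subrKA (G (q%:R / 16 ^+ (l0 + m)))).
apply: (le_trans (ler_normD _ _)).
rewrite big_nat_recr/= ?leq_addr// [leRHS]addrC lerD//.
apply: (le_trans h1); rewrite ler_wpM2r// ler_nat.
by rewrite ltnW// ltn_mod.
Qed.

(** Increments along the grid are again deviations, of the difference set centred at [q - p], so the
    tail bound applies to them with their small variance. *)
Lemma deviation_setD (A B : set R) (p q : R) n w : A `<=` B ->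
  deviation X B q n w - deviation X A p n w =
  deviation X (B `\` A) (q - p) n w.
Proof.
move=> AB; rewrite /deviation -sumrB; apply: eq_bigr => i _.
have -> : \1_(B `\` A) (X i w) = \1_B (X i w) - \1_A (X i w) :> R.
  rewrite !indicE; have [Ax|Ax] := pselect (A (X i w)).
    by rewrite (mem_set Ax) (mem_set (AB _ Ax)) memNset ?subrr// => -[].
  rewrite (memNset Ax) subr0; have [Bx|Bx] := pselect (B (X i w)).
    by rewrite !mem_set.
  by rewrite !memNset// => -[].
ring.
Qed.

Lemma ler_deviation (A B : set R) (p q : R) n w : A `<=` B -> q <= p ->
  deviation X A p n w <= deviation X B q n w.
Proof.
move=> AB qp; apply: ler_sum => i _; apply: lerB => //.
rewrite !indicE; have [Ax|Ax] := pselect (A (X i w)).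
  by rewrite !mem_set//; exact: AB.
by rewrite memNset.
Qed.

Lemma deviationD (A : set R) (p q : R) n w :
  deviation X A (p + q) n w = deviation X A p n w - n%:R * q.
Proof.
rewrite /deviation -[n in n%:R]card_ord mulr_natl -sumr_const -sumrB.
by apply: eq_bigr => i _; ring.
Qed.

Variable F : R -> R.
Hypotheses (F_nondecreasing : {homo F : x y / x <= y})
  (F01 : forall x, 0 <= F x <= 1).
Local Notation below r := [set x | F x < r].

(** The half-line is sandwiched between two grid sets; moving the centre by one mesh costs [n / m].
    The alternative [<= 0] covers [F t = 1]: there [{F < 1}] may miss points of the half-line, but
    every term of the deviation is at most 0. *)
Lemma deviation_discretize n w t m : (0 < m)%N -> exists2 j : nat, (j < m)%N &
  [/\ j%:R / m%:R <= F t, F t <= j.+1%:R / m%:R,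
    deviation X (below (j%:R / m%:R)) (j%:R / m%:R) n w - n%:R / m%:R <=
      deviation X `]-oo, t] (F t) n w &
    deviation X `]-oo, t] (F t) n w <= 0 \/
    deviation X `]-oo, t] (F t) n w <=
      deviation X (below (j.+1%:R / m%:R)) (j.+1%:R / m%:R) n w + n%:R / m%:R].
Proof.
move=> m0; have mp : 0 < m%:R :> R by rewrite ltr0n.
have /andP[F0 F1] := F01 t.
have lower (j : nat) : j%:R / m%:R <= F t -> F t <= j.+1%:R / m%:R ->
    deviation X (below (j%:R / m%:R)) (j%:R / m%:R) n w - n%:R / m%:R <=
      deviation X `]-oo, t] (F t) n w.
  move=> h1 h2; rewrite -deviationD; apply: ler_deviation.
    move=> x /= /lt_le_trans /(_ h1); rewrite in_itv/=; apply: contraTT.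
    by rewrite -ltNge -leNgt => /ltW; exact: F_nondecreasing.
  by apply: (le_trans h2); rewrite -natr1 mulrDl mul1r.
have [F1'|F1'] := ltP (F t) 1; last first.
  have F1e : F t = 1 by apply/eqP; rewrite eq_le F1.
  exists m.-1; first by rewrite ltn_predL.
  have h1 : m.-1%:R / m%:R <= F t.
    by rewrite F1e ler_pdivrMr// mul1r ler_nat leq_pred.
  have h2 : F t <= m.-1.+1%:R / m%:R by rewrite prednK// F1e divff// gt_eqF.
  split => //; first exact: lower.
  left; rewrite F1e /deviation; apply: sumr_le0 => i _.
  by rewrite indicE; case: (_ \in _); rewrite /= ?subrr// sub0r oppr_le0.
have /truncn_itv : 0 <= F t * m%:R by rewrite mulr_ge0// ltW.
move: (Num.truncn _) => j /andP[j1 j2]; exists j.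
  by rewrite -(ltr_nat R) (le_lt_trans j1)// gtr_pMl.
have h1 : j%:R / m%:R <= F t by rewrite ler_pdivrMr.
have h2 : F t < j.+1%:R / m%:R by rewrite ltr_pdivlMr.
split => //; [exact: ltW|exact/lower/ltW|right].
rewrite -[n%:R / _]opprK -mulrN -deviationD; apply: ler_deviation.
  by move=> x /=; rewrite in_itv/= => /F_nondecreasing /le_lt_trans; apply.
by rewrite -[j.+1%:R]natr1 mulrDl mul1r addrK.
Qed.

(** The error has three sources: the descent from level [l0 + m] to [l0], one more finest cell
    because the upper bound involves the neighbour [j + 1], and the mesh of the sandwich. *)
Lemma deviation_chain n w t (v : nat -> R) l0 m :
  (forall l i, (l0 <= l <= l0 + m)%N -> (i < 16 ^ l)%N ->
    `|deviation X (below (i.+1%:R / 16 ^+ l) `\` below (i%:R / 16 ^+ l))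
       (16 ^- l) n w| <= v l) ->
  exists2 j : nat, (j < 16 ^ l0)%N &
  j%:R / 16 ^+ l0 <= F t <= j.+1%:R / 16 ^+ l0 /\
  `|deviation X `]-oo, t] (F t) n w| <=
    `|deviation X (below (j%:R / 16 ^+ l0)) (j%:R / 16 ^+ l0) n w| +
    (\sum_(l0 <= l < l0 + m) 16 * v l.+1 + v (l0 + m) + n%:R / 16 ^+ (l0 + m)).
Proof.
pose G r := deviation X (below r) r n w => hv.
have hG l i : (l0 <= l <= l0 + m)%N -> (i < 16 ^ l)%N ->
    `|G (i.+1%:R / 16 ^+ l) - G (i%:R / 16 ^+ l)| <= v l.
  move=> lm il; rewrite /G deviation_setD; last first.
    move=> x /= /lt_le_trans; apply; rewrite ler_pM2r ?invr_gt0 ?exprn_gt0//.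
    by rewrite ler_nat.
  rewrite -mulrBl -natr1 addrAC subrr add0r mul1r natr1.
  exact: hv.
have [j jlt] := @deviation_discretize n w t (16 ^ (l0 + m)) (expn_gt0 16 _).
rewrite natrX => -[j1 j2 lo up].
exists (j %/ 16 ^ m)%N.
  by rewrite ltn_divLR ?expn_gt0// -expnD.
have e16 k : 0 < 16 ^+ k :> R by rewrite exprn_gt0.
split.
  apply/andP; split.
    apply: le_trans j1; rewrite ler_pdivlMr// exprD mulrA mulfVK ?gt_eqF//.
    by rewrite -natrX -natrM ler_nat leq_trunc_div.
  apply: (le_trans j2); rewrite ler_pdivrMr// exprD mulrA mulfVK ?gt_eqF//.
  by rewrite -natrX -natrM ler_nat ltn_ceil// expn_gt0.
have c := base16_chain hG jlt.
have lm : (l0 <= l0 + m <= l0 + m)%N by rewrite leq_addr leqnn.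
have s := hG _ _ lm jlt.
have v0 : 0 <= v (l0 + m)%N by apply: le_trans s.
have c0 := le_trans (normr_ge0 _) c.
have n0 : 0 <= n%:R / 16 ^+ (l0 + m) :> R by rewrite divr_ge0// ltW.
have GE r : deviation X (below r) r n w = G r by [].
rewrite !GE in lo up *; move: c s lo up.
move: (G (j.+1%:R / _)) (G (j%:R / _)) (G ((j %/ _)%:R / _)) => g2 g1 g0 c s lo up.
move: c s; rewrite !ler_norml => /andP[c1 c2] /andP[s1 s2].
have ng := ler_norm g0; have ng' := ler_norm (- g0); rewrite normrN in ng'.
have gg := normr_ge0 g0.
apply/andP; split; first by lra.
by case: up => up; lra.
Qed.

End discretization.

(** * Exceptional events and their probability *)

Section block.
Context {d : measure_display} {T : measurableType d} {R : realType}.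
Variables (P : probability T R) (X : nat -> {RV P >-> R}) (F : R -> R).
Hypotheses (X_indep : mutually_independent X)
  (F_nondecreasing : {homo F : x y / x <= y})
  (F01 : forall x, 0 <= F x <= 1)
  (mF : forall r, measurable [set x | F x < r])
  (PF : forall i r, 0 <= r <= 1 -> P (X i @^-1` [set x | F x < r]) = r%:E).
Local Notation below r := [set x | F x < r].
Local Notation cell l i :=
  (below (i.+1%:R / 16 ^+ l) `\` below (i%:R / 16 ^+ l)).
Local Notation exceed A p u N :=
  [set w | exists2 n, (n <= N)%N & (u <= `|deviation X A p n w|)%R].

(* Exceptional event of the chaining: it involves the grid of mesh [16 ^- l0]
   (threshold [u]), all cells of the levels [l0, ..., l0 + m] (threshold [v l]) and
   the last grid point, whose variance is at most [16 ^- l0] (threshold [v l0]). *)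
Definition bad_event (u : R) (v : nat -> R) l0 m N : set T :=
  (\big[setU/set0]_(j < 16 ^ l0)
    exceed (below (j%:R / 16 ^+ l0)) (j%:R / 16 ^+ l0) u N) `|`
  (\big[setU/set0]_(l0 <= l < (l0 + m).+1) \big[setU/set0]_(i < 16 ^ l)
    exceed (cell l i) (16 ^- l) (v l) N) `|`
  exceed (below (1 - 16 ^- l0)) (1 - 16 ^- l0) (v l0) N.

Lemma grid_point_ge0_le1 l i : (i <= 16 ^ l)%N -> 0 <= (i%:R / 16 ^+ l : R) <= 1.
Proof.
move=> il; rewrite divr_ge0//= ?exprn_ge0// ler_pdivrMr ?exprn_gt0// mul1r.
by rewrite -natrX ler_nat.
Qed.

Lemma mem_bigsetU_ord (E : nat -> set T) n i w : (i < n)%N -> E i w ->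
  (\big[setU/set0]_(j < n) E j) w.
Proof. by move=> i_n Ew; rewrite -bigcup_mkord; exists i. Qed.

Lemma measurable_cell l i : measurable (cell l i).
Proof. exact: measurableD. Qed.

Lemma probability_cell l i k : (i < 16 ^ l)%N ->
  P (X k @^-1` cell l i) = (16 ^- l)%:E.
Proof.
move=> il.
have sub : X k @^-1` below (i%:R / 16 ^+ l) `<=` X k @^-1` below (i.+1%:R / 16 ^+ l).
  move=> w /= /lt_le_trans; apply; rewrite ler_pM2r ?invr_gt0 ?exprn_gt0//.
  by rewrite ler_nat.
have -> : X k @^-1` cell l i = X k @^-1` below (i.+1%:R / 16 ^+ l) `\`
    X k @^-1` below (i%:R / 16 ^+ l) by [].
rewrite measureD; last 3 first.
- exact: measurable_funPTI.
- exact: measurable_funPTI.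
- by apply: le_lt_trans (ltry 1); apply: probability_le1; exact: measurable_funPTI.
rewrite (setIidr sub).
apply: (eq_trans (f_equal2 (fun x y => (x - y)%E)
  (PF k (grid_point_ge0_le1 il)) (PF k (grid_point_ge0_le1 (ltnW il))))).
by rewrite -EFinB -mulrBl -natr1 addrAC subrr add0r mul1r.
Qed.

Lemma measurable_exceed (A : set R) (p u : R) N : measurable A ->
  measurable (exceed A p u N).
Proof. by move=> mA; exact: measurable_deviation_exceeds. Qed.

Lemma measurable_bad_event u v l0 m N : measurable (bad_event u v l0 m N).
Proof.
apply: measurableU; last exact: measurable_exceed.
apply: measurableU.
  by apply: bigsetU_measurable => j _; exact: measurable_exceed.
apply: bigsetU_measurable => l _; apply: bigsetU_measurable => i _.
by apply: measurable_exceed; exact: measurable_cell.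
Qed.

(** For [F t] near 0 the coarse index is [j = 0] and [{F < 0}] is empty, so the coarse term
    vanishes; near 1 it is the last grid point, for which [bad_event] has the separate threshold
    [v l0]. *)
Lemma deviation_le_off_bad_event u v l0 m N n w t : (n <= N)%N ->
  ~ bad_event u v l0 m N w ->
  let tau := \sum_(l0 <= l < l0 + m) 16 * v l.+1 + v (l0 + m)%N +
    n%:R / 16 ^+ (l0 + m) in
  `|deviation X `]-oo, t] (F t) n w| <= u + tau /\
  (F t < 16 ^- l0 \/ 1 - 16 ^- l0 < F t ->
   `|deviation X `]-oo, t] (F t) n w| <= v l0 + tau).
Proof.
move=> nN wbad tau.
have e0 : 0 < 16 ^+ l0 :> R by rewrite exprn_gt0.
have notin A p u' : ~ exceed A p u' N w -> `|deviation X A p n w| <= u'.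
  by move=> h; rewrite leNgt; apply/negP => /ltW uw; apply: h; exists n.
have hcell l i : (l0 <= l <= l0 + m)%N -> (i < 16 ^ l)%N ->
    `|deviation X (cell l i) (16 ^- l) n w| <= v l.
  move=> /andP[l1 l2] il; apply: notin => h; apply: wbad; left; right.
  rewrite -bigcup_seq; exists l; first by rewrite /= mem_index_iota l1 ltnS.
  exact: (mem_bigsetU_ord (E := fun i => exceed (cell l i) (16 ^- l) (v l) N) il h).
have hcoarse j : (j < 16 ^ l0)%N ->
    `|deviation X (below (j%:R / 16 ^+ l0)) (j%:R / 16 ^+ l0) n w| <= u.
  move=> jl; apply: notin => h; apply: wbad; left; left.
  exact: (mem_bigsetU_ord
    (E := fun j => exceed (below (j%:R / 16 ^+ l0)) (j%:R / 16 ^+ l0) u N) jl h).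
have hlast : `|deviation X (below (1 - 16 ^- l0)) (1 - 16 ^- l0) n w| <= v l0.
  by apply: notin => h; apply: wbad; right.
have v0 : 0 <= v l0 by apply: le_trans hlast.
have [j jl [/andP[j1 j2] hj]] :=
  deviation_chain F_nondecreasing F01 (n := n) (w := w) t hcell.
split; first by apply: (le_trans hj); rewrite lerD2r hcoarse.
move=> loc; apply: (le_trans hj); rewrite lerD2r.
case: loc => loc.
  have j0 : j = 0%N.
    apply/eqP; rewrite -leqn0 -ltnS -(ltr_nat R).
    rewrite -(ltr_pM2r (x := (16 ^+ l0)^-1)) ?invr_gt0// mul1r.
    exact: le_lt_trans j1 loc.
  rewrite j0 mul0r /deviation big1 ?normr0// => i _.
  rewrite subr0 indicE memNset//= => /lt_le_trans.
  by move=> /(_ (F (X i w))); case/andP: (F01 (X i w)) => h _ /(_ h); rewrite ltxx.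
have jE : j.+1 = (16 ^ l0)%N.
  apply/eqP; rewrite eqn_leq jl /= -ltnS -(ltr_nat R) natrX.
  have : 1 - 16 ^- l0 < j.+1%:R / 16 ^+ l0 :> R by exact: lt_le_trans loc j2.
  by move=> h; rewrite ltr_pdivlMr// mulrBl mulVf ?gt_eqF// mul1r ltrBlDr natr1 in h.
have jE' : j%:R / 16 ^+ l0 = 1 - 16 ^- l0 :> R.
  by rewrite -natrX -jE -natr1; field; rewrite natr1 gt_eqF// ltr0n.
by rewrite jE'.
Qed.

Lemma probability_exceed_le (A : set R) (p q u s : R) N : measurable A ->
  (forall i, P (X i @^-1` A) = p%:E) -> p * (1 - p) <= q -> 0 <= s <= 1 ->
  (P (exceed A p u N) <= (2 * expR (N%:R * (q * s ^+ 2 * (1 + s) / 2) - s * u))%:E)%E.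
Proof.
move=> mA pA pq s01; have /andP[s0 s1] := s01.
apply: (le_trans (deviation_tail X_indep mA pA u N s01)).
rewrite lee_fin ler_pM2l// ler_expR lerD2r ler_wpM2l//.
rewrite ler_wpM2r// ler_wpM2r// ?addr_ge0//.
by rewrite ler_wpM2r// sqr_ge0.
Qed.

Lemma measure_bigsetU_le (I : Type) (r : seq I) (E : I -> set T) :
  (forall i, measurable (E i)) ->
  (P (\big[setU/set0]_(i <- r) E i) <= \sum_(i <- r) P (E i))%E.
Proof.
move=> mE; elim: r => [|i r ih]; first by rewrite !big_nil measure0.
rewrite !big_cons; apply: (le_trans (measureU2 _ _ _)) => //.
  exact: bigsetU_measurable.
exact: leeD.
Qed.

(** Union bound. Only the coarse grid keeps the sharp factor [(1 + s) / 8], from variance at most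
    1/4. For the cells and the last grid point the variance is at most [16 ^- l], and the factor
    [(1 + r l) / 2 <= 1] is dropped since constants do not matter there. *)
Lemma probability_bad_event_le u v l0 m N (s : R) (r : nat -> R) :
  0 <= s <= 1 -> (forall l, (l0 <= l <= l0 + m)%N -> 0 <= r l <= 1) ->
  (P (bad_event u v l0 m N) <=
   (16 ^+ l0 * (2 * expR (N%:R * (s ^+ 2 * (1 + s) / 8) - s * u)) +
    \sum_(l0 <= l < (l0 + m).+1)
      16 ^+ l * (2 * expR (N%:R * (16 ^- l * r l ^+ 2) - r l * v l)) +
    2 * expR (N%:R * (16 ^- l0 * r l0 ^+ 2) - r l0 * v l0))%:E)%E.
Proof.
move=> s01 r01.
have fine_scale l A p : (l0 <= l <= l0 + m)%N -> measurable A ->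
    (forall i, P (X i @^-1` A) = p%:E) -> p * (1 - p) <= 16 ^- l ->
    (P (exceed A p (v l) N) <=
      (2 * expR (N%:R * (16 ^- l * r l ^+ 2) - r l * v l))%:E)%E.
  move=> lm mA pA pl; apply: (le_trans (probability_exceed_le _ _ mA pA pl (r01 _ lm))).
  rewrite lee_fin ler_pM2l// ler_expR lerD2r ler_wpM2l//.
  have /andP[r0 r1] := r01 _ lm.
  rewrite -mulrA ler_piMr//; last by rewrite ler_pdivrMr//; lra.
  by rewrite mulr_ge0// ?sqr_ge0// invr_ge0 exprn_ge0.
have l0l0 : (l0 <= l0 <= l0 + m)%N by rewrite leqnn leq_addr.
have e0 l : 0 < 16 ^+ l :> R by rewrite exprn_gt0.
have e1 : 16 ^- l0 <= 1 :> R by rewrite invf_le1// exprn_ege1// ler1n.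
rewrite /bad_event; apply: (le_trans (measureU2 _ _ _)).
- apply: measurableU.
    by apply: bigsetU_measurable => j _; exact: measurable_exceed.
  apply: bigsetU_measurable => l _; apply: bigsetU_measurable => i _.
  by apply: measurable_exceed; exact: measurable_cell.
- exact: measurable_exceed.
rewrite EFinD leeD//; last first.
  apply: fine_scale => // [i|].
    by rewrite PF// subr_ge0 e1 gerBl invr_ge0 ltW.
  by rewrite subKr ler_piMl ?gerBl ?invr_ge0 ?(ltW (e0 _)).
apply: (le_trans (measureU2 _ _ _)).
- by apply: bigsetU_measurable => j _; exact: measurable_exceed.
- apply: bigsetU_measurable => l _; apply: bigsetU_measurable => i _.
  by apply: measurable_exceed; exact: measurable_cell.
rewrite EFinD leeD//.
  apply: le_trans (measure_bigsetU_le _ _) _; first by move=> i; exact: measurable_exceed.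
  rewrite (_ : 16 ^+ l0 * _ = \sum_(j < 16 ^ l0)
      2 * expR (N%:R * (s ^+ 2 * (1 + s) / 8) - s * u)); last first.
    by rewrite sumr_const card_ord -[RHS]mulr_natl natrX.
  rewrite -sumEFin lee_sum// => j _.
  have j01 := grid_point_ge0_le1 (ltnW (ltn_ord j)).
  apply: le_trans (probability_exceed_le (q := 1 / 4) _ _ _ _ _ s01) _ => //.
  - by move=> i; rewrite PF.
  - move: j01; move: (_ / _) => p _.
    by have := sqr_ge0 (p - 1 / 2); rewrite !expr2; lra.
  rewrite lee_fin (_ : 1 / 4 * s ^+ 2 * (1 + s) / 2 = s ^+ 2 * (1 + s) / 8)//.
  by field.
apply: le_trans (measure_bigsetU_le _ _) _.
  move=> l; apply: bigsetU_measurable => i _.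
  by apply: measurable_exceed; exact: measurable_cell.
rewrite -sumEFin big_nat_cond [leRHS]big_nat_cond lee_sum// => l.
rewrite andbT ltnS => lm.
apply: le_trans (measure_bigsetU_le _ _) _.
  by move=> i; apply: measurable_exceed; exact: measurable_cell.
rewrite (_ : 16 ^+ l * _ = \sum_(j < 16 ^ l)
    2 * expR (N%:R * (16 ^- l * r l ^+ 2) - r l * v l)); last first.
  by rewrite sumr_const card_ord -[RHS]mulr_natl natrX.
rewrite -sumEFin lee_sum// => j _; apply: fine_scale => //.
- exact: measurable_cell.
- by move=> i; exact: probability_cell.
by rewrite ler_piMr ?invr_ge0 ?ltW// gerBl invr_ge0 ltW.
Qed.

(** A linear threshold makes the bad event exponentially small in [n], so one fixed grid suffices
    ([m = 0]), with a separate event for each [n] and a geometric series. *)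
Lemma uniform_deviation_summable c : 0 < c -> exists E : nat -> set T,
  [/\ forall n, measurable (E n), (\sum_(0 <= n <oo) P (E n) < +oo)%E &
  forall n w t, ~ E n w -> `|deviation X `]-oo, t] (F t) n w| <= c * n%:R].
Proof.
move=> c0.
(* One third of [c] each for the coarse deviation, one cell and the mesh. [c' <= 1 / 3] also makes
   [c'] an admissible exponential parameter and keeps both coefficients of [c' ^+ 2] in the
   exponents below 1/2. *)
have [c' [c'0 c'c c'1]] : exists c', [/\ 0 < c', 3 * c' <= c & c' <= 1 / 3].
  exists (Num.min c 1 / 3); split.
  - by rewrite divr_gt0// lt_min c0 ltr01.
  - by rewrite mulrC divfK// ge_min lexx.
  - by rewrite ler_pM2r// ge_min lexx orbT.
have [l0 hl0] : exists l0, 16 ^- l0 <= c'.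
  have [||l /andP[_ h]] := @exists_bracket _ 16 (c'^-1).
  - by rewrite ltr1n.
  - by rewrite invf_ge1//; lra.
  exists l.+1; rewrite -(invrK c') lef_pV2 ?posrE ?exprn_gt0 ?invr_gt0//.
  exact: ltW.
pose E n := bad_event (n%:R * c') (fun=> n%:R * c') l0 0 n.
exists E; split.
- by move=> n; exact: measurable_bad_event.
- pose x := c' ^+ 2 / 2.
  have x0 : 0 < x by rewrite divr_gt0// exprn_gt0.
  pose q := expR (- x).
  have q0 : 0 < q by exact: expR_gt0.
  have q1 : q < 1 by rewrite /q expR_lt1 oppr_lt0.
  pose C := 16 ^+ l0 * 2 + 16 ^+ l0 * 2 + 2 : R.
  have C0 : 0 <= C by rewrite !addr_ge0// mulr_ge0// exprn_ge0.
  apply: (@nneseries_lty_telescope _ _ (fun n => C * q ^+ n / (1 - q)) 0).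
  + move=> n; rewrite measure_ge0/=; apply: le_lt_trans (ltry 1).
    by apply: probability_le1; exact: measurable_bad_event.
  + by move=> n; rewrite divr_ge0 ?subr_ge0 ?(ltW q1)// mulr_ge0// exprn_ge0// ltW.
  + move=> n _.
    have -> : C * q ^+ n / (1 - q) - C * q ^+ n.+1 / (1 - q) = C * q ^+ n.
      by rewrite exprS; field; rewrite subr_eq0 gt_eqF.
    have c'01 : 0 <= c' <= 1 by lra.
    apply: (le_trans (probability_bad_event_le _ _ _ c'01 (fun _ _ => c'01))).
    rewrite lee_fin addn0 big_nat1 /C /q -expRM_natl.
    have n0 : 0 <= n%:R :> R by [].
    have small y : y <= 1 / 2 ->
        expR (n%:R * (y * c' ^+ 2) - c' * (n%:R * c')) <= expR (n%:R * - x).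
      move=> y12; rewrite ler_expR /x.
      rewrite (_ : c' * (n%:R * c') = n%:R * c' ^+ 2); last by rewrite expr2; ring.
      rewrite -mulrBr ler_wpM2l//.
      have : 0 <= (1 / 2 - y) * c' ^+ 2 by rewrite mulr_ge0 ?sqr_ge0// subr_ge0.
      lra.
    have h16 : 16 ^- l0 <= 1 / 2 :> R by lra.
    have s1 := small _ h16.
    have : expR (n%:R * (c' ^+ 2 * (1 + c') / 8) - c' * (n%:R * c')) <=
        expR (n%:R * - x).
      by rewrite -(mulrA (c' ^+ 2)) (mulrC (c' ^+ 2)); apply: small; lra.
    move: s1; move: (expR _) (expR _) (expR _) => E1 E2 E3 s1 s2.
    have e16 : 0 <= 16 ^+ l0 :> R by rewrite exprn_ge0.
    have := ler_wpM2l e16 s1; have := ler_wpM2l e16 s2.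
    lra.
move=> n w t wE.
have [h _] := deviation_le_off_bad_event t (leqnn n) wE.
apply: (le_trans h); rewrite addn0 big_geq// add0r.
have n0 : 0 <= n%:R :> R by [].
have h1 := ler_wpM2l n0 hl0; have h2 := ler_wpM2l n0 c'c.
by rewrite mulrC; lra.
Qed.

(** * Geometric blocks and the law of the iterated logarithm *)

Lemma sum_inverse_pow2_le l0 m : \sum_(l0 <= l < l0 + m) 2 ^- l <= 2 * 2 ^- l0 :> R.
Proof.
suff -> : \sum_(l0 <= l < l0 + m) 2 ^- l = 2 * 2 ^- l0 - 2 * 2 ^- (l0 + m) :> R.
  by rewrite gerBl mulr_ge0// invr_ge0 exprn_ge0.
elim: m => [|m ih]; first by rewrite addn0 big_geq// subrr.
rewrite addnS big_nat_recr ?leq_addr//= ih exprS.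
by field; rewrite !expf_neq0.
Qed.

(* The thresholds are [u = (1 + e/2) sigma] and [v l = eta sigma 2 ^- l] with
   [eta = e / 80]. At level [l] the exponent of the tail bound is
   [- eta^2 4^l L / 16], and [128 <= eta^2 2^l0] brings it below [- 8 (l + 1) L],
   which beats the [16 ^ l] cells. *)
Lemma block_deviation e l0 : 0 < e <= 1 -> 128 <= (e / 80) ^+ 2 * 2 ^+ l0 ->
  exists2 c, 0 < c & forall B L : R, 0 < B -> 1 <= L ->
  let sigma := Num.sqrt (B * L / 2) in sigma / B <= c ->
  exists E : set T, [/\ measurable E,
    (P E <= ((2 * 16 ^+ l0 + 6) * expR (- (1 + e / 4) * L))%:E)%E &
    forall n w t, n%:R <= (1 + e / 2) * B -> ~ E w ->
    `|deviation X `]-oo, t] (F t) n w| <= (1 + e) * sigma /\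
    (F t < 16 ^- l0 \/ 1 - 16 ^- l0 < F t ->
     `|deviation X `]-oo, t] (F t) n w| <= e * sigma)].
Proof.
move=> /andP[e0 e1] hl0; pose eta := e / 80.
have eta0 : 0 < eta by rewrite divr_gt0.
have etaE : eta = e / 80 by [].
rewrite -etaE in hl0; clearbody eta.
have p0 (x : R) l : 0 < x -> 0 < x ^+ l by move=> ?; rewrite exprn_gt0.
(* [e / 32] gives [s <= e / 8] below; the second bound makes the bracketed ratio that defines [m] at
   least 1. *)
exists (Num.min (e / 32) (4 / (eta * 8 ^+ l0))).
  by rewrite lt_min !divr_gt0// mulr_gt0// p0.
move=> B L B0 L1 sigma; rewrite le_min => /andP[hs1 hs2].
have sigma0 : 0 < sigma by rewrite sqrtr_gt0 divr_gt0// mulr_gt0// (lt_le_trans _ L1).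
have sigma2 : sigma ^+ 2 = B * L / 2.
  by rewrite sqr_sqrtr// divr_ge0// mulr_ge0 ?(ltW B0)// (le_trans _ L1).
clearbody sigma.
(* [m] is the last depth at which the parameter [r (l0 + m)] is at most 1; the upper half of the
   bracket later bounds the final mesh by [4 eta sigma]. *)
have [m /andP[hm1 hm2]] : exists m,
    8 ^+ m <= 4 * B / (eta * sigma) / 8 ^+ l0 < 8 ^+ m.+1.
  apply: exists_bracket; first by rewrite ltr1n.
  have es0 : 0 < eta * sigma by rewrite mulr_gt0.
  rewrite ler_pdivlMr ?p0// mul1r ler_pdivlMr//.
  move: hs2; rewrite ler_pdivrMr// mulrAC ler_pdivlMr ?mulr_gt0 ?p0//.
  by move=> h; apply: le_trans h; rewrite le_eqVlt; apply/orP; left; apply/eqP; ring.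
pose N := Num.truncn ((1 + e / 2) * B).
have /truncn_itv /andP[N1 _] : 0 <= (1 + e / 2) * B.
  by rewrite mulr_ge0 ?ltW//; lra.
pose u := (1 + e / 2) * sigma.
pose v l := eta * sigma * 2 ^- l.
(* [s] minimizes [B s^2 / 8 - s sigma], with minimum [- L]; likewise [r l] minimizes
   [2 B 16^-l r^2 - r * v l]. *)
pose s := 4 * sigma / B.
pose r l := eta * sigma * 8 ^+ l / (4 * B).
exists (bad_event u v l0 m N); split.
- exact: measurable_bad_event.
- have s0 : 0 <= s by rewrite divr_ge0 ?ltW// mulr_gt0.
  have se : s <= e / 8 by rewrite /s -mulrA; lra.
  have s01 : 0 <= s <= 1 by rewrite s0; lra.
  have r01 l : (l0 <= l <= l0 + m)%N -> 0 <= r l <= 1.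
    move=> /andP[_ lm]; rewrite divr_ge0/= ?mulr_ge0 ?exprn_ge0//
      ?(ltW B0) ?(ltW eta0) ?(ltW sigma0)//.
    rewrite ler_pdivrMr ?mulr_gt0// mul1r.
    have : 8 ^+ l * (eta * sigma) <= 4 * B.
      rewrite -ler_pdivlMr ?mulr_gt0//; apply: (@le_trans _ _ (8 ^+ (l0 + m))).
        by rewrite ler_weXn2l// ler1n.
      by rewrite addnC exprD -ler_pdivlMr ?p0.
    by rewrite mulrC.
  apply: (le_trans (probability_bad_event_le u v N s01 r01)).
  rewrite lee_fin; set EE := expR (- (1 + e / 4) * L).
  have EE0 : 0 <= EE by exact: expR_ge0.
  have B2 : N%:R <= 2 * B.
    apply: (le_trans N1); rewrite ler_wpM2r ?(ltW B0)//; lra.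
  have c1 : expR (N%:R * (s ^+ 2 * (1 + s) / 8) - s * u) <= EE.
    rewrite ler_expR.
    have s2B : B * s ^+ 2 = 8 * L.
      by rewrite /s expr_div_n exprMn sigma2; field; rewrite gt_eqF.
    have su : s * u = 2 * (1 + e / 2) * L.
      transitivity (4 * (1 + e / 2) * sigma ^+ 2 / B).
        by rewrite /s /u expr2; field; rewrite gt_eqF.
      by rewrite sigma2; field; rewrite gt_eqF.
    have g0 : 0 <= s ^+ 2 * (1 + s) / 8.
      by rewrite divr_ge0// mulr_ge0 ?sqr_ge0// addr_ge0.
    have := ler_wpM2r g0 N1; rewrite su.
    have -> : (1 + e / 2) * B * (s ^+ 2 * (1 + s) / 8) = (1 + e / 2) * (1 + s) * L.
      transitivity ((1 + e / 2) * (1 + s) * (B * s ^+ 2) / 8); first by field.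
      by rewrite s2B; field.
    (* The exponent is at most [- (1 + e / 2) (1 - s) L], and [s <= e / 8] leaves the margin
       [e / 4]. *)
    have : 0 <= ((1 + e / 2) * (1 - s) - (1 + e / 4)) * L.
      rewrite mulr_ge0 ?(le_trans _ L1)//.
      have : 0 <= (1 + e / 2) * (e / 8 - s) by rewrite mulr_ge0//; lra.
      have : 0 <= e * (1 - e) by rewrite mulr_ge0//; lra.
      lra.
    by rewrite -/N; lra.
  have c2 l : (l0 <= l)%N ->
      N%:R * (16 ^- l * r l ^+ 2) - r l * v l <= - (8 * (l.+1)%:R) * L.
    move=> l0l.
    pose W := eta ^+ 2 * L * (2 ^+ l * 2 ^+ l) / 2.
    have e16 : 16 ^+ l = 2 ^+ l * 2 ^+ l * 2 ^+ l * 2 ^+ l :> R.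
      by rewrite -!exprMn; congr (_ ^+ _); ring.
    have e8 : 8 ^+ l = 2 ^+ l * 2 ^+ l * 2 ^+ l :> R.
      by rewrite -!exprMn; congr (_ ^+ _); ring.
    have h2l := p0 2 l (ltr0n _ 2).
    have WE : W = eta ^+ 2 * sigma ^+ 2 * (2 ^+ l * 2 ^+ l) / B.
      by rewrite sigma2 /W; field; rewrite gt_eqF.
    have r2 : 2 * B * (16 ^- l * r l ^+ 2) = W / 8.
      by rewrite WE /r e16 e8; field; rewrite !gt_eqF.
    have rv : r l * v l = W / 4.
      by rewrite WE /r /v e8; field; rewrite !gt_eqF.
    have g0 : 0 <= 16 ^- l * r l ^+ 2.
      by rewrite mulr_ge0 ?sqr_ge0// invr_ge0 exprn_ge0.
    have := ler_wpM2r g0 B2; rewrite r2 rv.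
    have l1 : l.+1%:R <= 2 ^+ l :> R.
      by rewrite -natrX ler_nat ltn_expl.
    have h3 : 128 <= eta ^+ 2 * 2 ^+ l.
      apply: (le_trans hl0); rewrite ler_wpM2l ?sqr_ge0// ler_weXn2l// ler1n//.
    have h4 : 128 * l.+1%:R * L <= eta ^+ 2 * 2 ^+ l * 2 ^+ l * L.
      by rewrite ler_wpM2r ?(le_trans _ L1)// ler_pM.
    by rewrite /W; lra.
  (* Of [8 (l + 1) L], the part [8 L] pays for [EE] and [8 l L] for [l * ln 32]. Against [16 ^ l]
     cells, [32 ^- l] leaves the summable [2 ^- l]. *)
  have c3 l : (l0 <= l)%N ->
      expR (N%:R * (16 ^- l * r l ^+ 2) - r l * v l) <= EE * 32 ^- l.
    move=> l0l; apply: (@le_trans _ _ (expR (- (8 * l.+1%:R) * L))).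
      by rewrite ler_expR c2.
    have -> : 32 ^- l = expR (- (ln 32 * l%:R)) :> R.
      by rewrite expRN mulrC expRM_natl lnK// posrE.
    rewrite /EE -expRD ler_expR -natr1.
    have ln32 : ln 32 <= 8 :> R.
      rewrite -(@ler_expR R) lnK ?posrE// (_ : 8 = 4 * 2 :> R); last by ring.
      rewrite -[4]/(4%:R) expRM_natl; apply: (@le_trans _ _ (3 ^+ 4)).
        by rewrite -natrX ler_nat.
      rewrite lerXn2r ?nnegrE ?expR_ge0//.
      by apply: le_trans (expR_ge1Dx _); lra.
    have l0' : 0 <= l%:R :> R by [].
    have := ler_wpM2r l0' ln32.
    have : 0 <= l%:R * (L - 1) by rewrite mulr_ge0// subr_ge0.
    have : 0 <= (1 - e) * L by rewrite mulr_ge0 ?(le_trans _ L1)// subr_ge0.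
    lra.
  have e32 l : 32 ^- l <= 1 :> R by rewrite invf_le1 ?p0// exprn_ege1// ler1n.
  (* The cells contribute 4 to the factor [2 * 16 ^+ l0 + 6], the coarse grid [2 * 16 ^+ l0] and the
     last grid point 2. *)
  have c4 : \sum_(l0 <= l < (l0 + m).+1)
      16 ^+ l * (2 * expR (N%:R * (16 ^- l * r l ^+ 2) - r l * v l)) <= 4 * EE.
    apply: (@le_trans _ _ (\sum_(l0 <= l < l0 + m.+1) 2 * EE * 2 ^- l)).
      rewrite addnS big_nat_cond [leRHS]big_nat_cond ler_sum// => l /andP[/andP[l0l _] _].
      rewrite (_ : 2 ^- l = 16 ^+ l * 32 ^- l); last first.
        rewrite (_ : 32 = 16 * 2 :> R); last by ring.
        by rewrite exprMn; field; rewrite !expf_neq0.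
      have := ler_wpM2l (exprn_ge0 l (ler0n R 16)) (c3 l l0l).
      lra.
    rewrite -mulr_sumr; apply: (@le_trans _ _ (2 * EE * 2)).
      rewrite ler_wpM2l ?mulr_ge0//; apply: (le_trans (sum_inverse_pow2_le _ _)).
      by rewrite ler_piMr// invf_le1 ?p0// exprn_ege1// ler1n.
    by lra.
  have c5 := le_trans (c3 l0 (leqnn _)) (ler_piMr EE0 (e32 _)).
  have := ler_wpM2l (exprn_ge0 l0 (ler0n R 16)) c1.
  move: c4 c5; lra.
move=> n w t nN wE.
have n_N : (n <= N)%N by rewrite /N truncn_ge_nat// mulr_ge0 ?(ltW B0)//; lra.
have es0 : 0 < eta * sigma by rewrite mulr_gt0.
have [h1 h2] := deviation_le_off_bad_event t n_N wE.
move: h1 h2; set tau := (_ + n%:R / _) => h1 h2.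
(* 21 = 16 + 1 + 4: chaining sum, last cell, mesh. With [eta = e / 80] this fits in the room
   [e sigma / 2] left by [u]. *)
have htau : tau <= 21 * (eta * sigma).
  rewrite /tau /v -mulr_sumr -mulr_sumr.
  have a1 : \sum_(l0 <= l < l0 + m) 2 ^- l.+1 <= 1 :> R.
    under eq_bigr do rewrite exprS invfM.
    rewrite -mulr_sumr; have := sum_inverse_pow2_le l0 m.
    have : 2 ^- l0 <= 1 :> R by rewrite invf_le1 ?p0// exprn_ege1// ler1n.
    lra.
  have a2 : 2 ^- (l0 + m) <= 1 :> R by rewrite invf_le1 ?p0// exprn_ege1// ler1n.
  have a3 : n%:R / 16 ^+ (l0 + m) <= 4 * (eta * sigma).
    rewrite ler_pdivrMr ?p0//.
    have h3 : 4 * B < 8 ^+ (l0 + m) * 8 * (eta * sigma).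
      move: hm2; rewrite ltr_pdivrMr ?p0// ltr_pdivrMr//.
      by rewrite exprS exprD; lra.
    have h4 : 8 ^+ (l0 + m) * (eta * sigma) <= 16 ^+ (l0 + m) * (eta * sigma).
      by rewrite ler_wpM2r ?(ltW es0)// lerXn2r ?nnegrE// ler_nat.
    have : 0 <= (1 - e) * B by rewrite mulr_ge0 ?subr_ge0// ltW.
    lra.
  have := ler_wpM2l (ltW es0) a1; have := ler_wpM2l (ltW es0) a2.
  lra.
have hv : v l0 <= eta * sigma.
  by rewrite /v ler_piMr ?(ltW es0)// invf_le1 ?p0// exprn_ege1// ler1n.
have es : eta * sigma = e * sigma / 80 by rewrite etaE; ring.
have es1 : 0 < e * sigma by rewrite mulr_gt0.
split; first by apply: (le_trans h1); rewrite /u; lra.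
by move=> /h2 h3; apply: (le_trans h3); lra.
Qed.

(* The bound near the two ends of the support is needed because the boundary
   kernels may have an absolute mass larger than 1. *)
Lemma law_iterated_logarithm e : 0 < e <= 1 -> exists2 delta, 0 < delta &
  \forall w \ae P, exists n0 : nat, forall n t, (n0 <= n)%N ->
  let sigma := Num.sqrt (n%:R * ln (ln n%:R) / 2) in
  `|deviation X `]-oo, t] (F t) n w| <= (1 + e) * sigma /\
  (F t < delta \/ 1 - delta < F t ->
   `|deviation X `]-oo, t] (F t) n w| <= e * sigma).
Proof.
move=> e01; have /andP[e0 e1] := e01.
(* The ratio of the blocks is the room that [block_deviation] leaves between [B] and the sample
   sizes it covers. *)
have th1 : 1 < 1 + e / 2 by rewrite ltrDl divr_gt0.
set th := 1 + e / 2 in th1.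
have th0 : 0 < th by exact: lt_trans th1.
have [l0 hl0] : exists l0, 128 <= (e / 80) ^+ 2 * 2 ^+ l0.
  have [l0 /(_ _ (leqnn _)) h] :=
    @exists_expr_ge _ 2 (128 / (e / 80) ^+ 2) (ltr1n _ 2).
  exists l0; rewrite mulrC -ler_pdivrMr// exprn_gt0// divr_gt0//.
exists (16 ^- l0); first by rewrite invr_gt0 exprn_gt0.
have [c c0 hblock] := block_deviation e01 hl0.
have [k1 hk1] := @exists_expr_ge _ th (expR (expR 1)) th1.
(* From [ln (ln B) <= 2 sqrt B], [sigma / B] is at most [B ^ (-1/4)], so [B >= c ^ (-4)] is enough.
   The index [k1] above ensures [L k >= 1], and the 2 in [k0] keeps [k.-1] positive in the
   telescoping. *)
have [k2 hk2] := @exists_expr_ge _ th ((c ^+ 2) ^- 2) th1.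
pose k0 := maxn 2 (maxn k1 k2).
pose B k := th ^+ k; pose L k := ln (ln (B k)).
have B0 k : 0 < B k by rewrite exprn_gt0.
have L1 k : (k0 <= k)%N -> 1 <= L k.
  rewrite !geq_max => /and3P[_ /hk1 h _].
  have h2 : expR 1 <= ln (B k) by rewrite -ler_expR lnK ?posrE.
  by rewrite -ler_expR lnK ?posrE// (lt_le_trans _ h2)// expR_gt0.
have hc k : (k0 <= k)%N -> Num.sqrt (B k * L k / 2) / B k <= c.
  move=> kk; move: (kk); rewrite !geq_max => /and3P[_ _ /hk2 h].
  have sB : 0 < Num.sqrt (B k) by rewrite sqrtr_gt0.
  have cs : (c ^+ 2)^-1 <= Num.sqrt (B k).
    rewrite -(@ler_pXn2r _ 2) ?nnegrE ?invr_ge0 ?sqr_ge0 ?sqrtr_ge0//.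
    by rewrite sqr_sqrtr ?(ltW (B0 _))// exprVn.
  rewrite ler_pdivrMr// -(@ler_pXn2r _ 2) ?nnegrE ?sqrtr_ge0//; last first.
    by rewrite mulr_ge0 ?(ltW c0) ?(ltW (B0 _)).
  rewrite sqr_sqrtr; last first.
    by rewrite divr_ge0// mulr_ge0 ?(ltW (B0 _))// (le_trans _ (L1 _ kk)).
  have := ln_ln_le (B0 k); rewrite -/(L k) => hL.
  have hc2 : 1 <= c ^+ 2 * Num.sqrt (B k) by rewrite mulrC -ler_pdivrMr ?exprn_gt0// mul1r.
  have hB : Num.sqrt (B k) ^+ 2 = B k by rewrite sqr_sqrtr ?(ltW (B0 _)).
  rewrite exprMn expr2 (mulrA (c ^+ 2)) (mulrC _ (B k)) -mulrA ler_pM2l//.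
  rewrite (_ : c ^+ 2 * B k = c ^+ 2 * Num.sqrt (B k) * Num.sqrt (B k)); last first.
    by rewrite -mulrA -expr2 hB.
  have : Num.sqrt (B k) <= c ^+ 2 * Num.sqrt (B k) * Num.sqrt (B k).
    by rewrite -[leLHS]mul1r ler_pM2r.
  lra.
have /choice[E hE] : forall k, exists E : set T, [/\ measurable E,
    (k0 <= k)%N -> (P E <= ((2 * 16 ^+ l0 + 6) * expR (- (1 + e / 4) * L k))%:E)%E &
    (k0 <= k)%N -> forall n w t, n%:R <= th * B k -> ~ E w ->
    `|deviation X `]-oo, t] (F t) n w| <= (1 + e) * Num.sqrt (B k * L k / 2) /\
    (F t < 16 ^- l0 \/ 1 - 16 ^- l0 < F t ->
     `|deviation X `]-oo, t] (F t) n w| <= e * Num.sqrt (B k * L k / 2))].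
  move=> k; have [kk|kk] := leqP k0 k; last first.
    by exists set0; split => //; rewrite leqNgt kk.
  have [E [E1 E2 E3]] := hblock (B k) (L k) (B0 k) (L1 k kk) (hc k kk).
  by exists E; split.
have mE k : measurable (E k) by have [] := hE k.
(* [L k = ln (k ln th)], so [expR (- (1 + s) L k)] is a constant times [k ^ (-(1 + s))]. *)
have sumE : (\sum_(0 <= k <oo) P (E k) < +oo)%E.
  pose s := e / 4; have s0 : 0 < s by rewrite divr_gt0.
  have lnth : 0 < ln th by rewrite ln_gt0.
  pose C := (2 * 16 ^+ l0 + 6) * ln th `^ (- (1 + s)) * s^-1.
  have C0 : 0 <= C.
    have c6 : 0 <= 2 * 16 ^+ l0 + 6 :> R by rewrite addr_ge0// mulr_ge0// exprn_ge0.
    by rewrite /C !mulr_ge0// ?powR_ge0// invr_ge0 ltW.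
  apply: (@nneseries_lty_telescope _ _ (fun k => C * k.-1%:R `^ (- s)) k0).
  - move=> k; rewrite measure_ge0/=; apply: le_lt_trans (ltry 1).
    exact: probability_le1.
  - by move=> k; rewrite mulr_ge0// powR_ge0.
  - move=> k kk; have [_ /(_ kk) h _] := hE k; apply: (le_trans h).
    rewrite lee_fin -mulrBr /C -!mulrA ler_wpM2l ?addr_ge0 ?mulr_ge0 ?exprn_ge0//.
    have k2' : (1 < k)%N by move: kk; rewrite geq_max => /andP[].
    case: k kk k2' {h} => // k kk; rewrite ltnS => k1'.
    have -> : expR (- (1 + e / 4) * L k.+1) =
        ln th `^ (- (1 + s)) * k.+1%:R `^ (- (1 + s)).
      rewrite -powRM ?(ltW lnth)// {1}/powR gt_eqF ?mulr_gt0//.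
      by rewrite /L /B lnXn// mulr_natr.
    by rewrite ler_wpM2l ?powR_ge0//=; exact: powR_telescope.
have PE0 := lim_sup_set_cvg0 mE sumE.
have mlim : measurable (lim_sup_set E).
  apply: bigcapT_measurable => n; exact: bigcup_measurable.
exists (lim_sup_set E); split => // w /= hw.
apply: contrapT => nlim; apply: hw.
have [m hm] : exists m, forall k, (m <= k)%N -> ~ E k w.
  apply: contrapT => h; apply: nlim => n _.
  apply: contrapT => h'; apply: h; exists n => k nk Ek; apply: h'.
  by exists k.
pose k3 := maxn k0 m.
exists (Num.truncn (th ^+ k3)).+1 => n t hn.
have hn' : th ^+ k3 < n%:R by rewrite -truncn_lt_nat ?exprn_ge0 ?(ltW th0).
have n1 : 1 <= n%:R :> R by rewrite ler1n (leq_ltn_trans _ hn).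
have [k /andP[kn nk]] := exists_bracket th1 n1.
have k3k : (k3 <= k)%N.
  rewrite leqNgt; apply/negP => kk3.
  have : th ^+ k.+1 <= th ^+ k3 by rewrite ler_weXn2l// ltW.
  by move=> /(lt_le_trans nk)/(lt_trans hn'); rewrite ltxx.
have k0k : (k0 <= k)%N by apply: leq_trans k3k; rewrite leq_maxl.
have mk : (m <= k)%N by apply: leq_trans k3k; rewrite leq_maxr.
have [_ _ /(_ k0k n w t) h] := hE k.
have nB : n%:R <= th * B k by rewrite -exprS ltW.
have [h1 h2] := h nB (hm k mk).
set sigma := Num.sqrt (n%:R * _ / 2).
(* The bound at the left end of the block is the stronger one, by monotonicity of [n ln (ln n)]
   there. *)
have sle : Num.sqrt (B k * L k / 2) <= sigma.
  rewrite ler_wsqrtr// ler_pM2r// ler_pM// ?(ltW (B0 _))//.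
    by rewrite (le_trans _ (L1 _ k0k)).
  have lnB : 0 < ln (B k).
    rewrite ltNge; apply/negP => /ln0 l_eq; have := L1 _ k0k.
    by rewrite /L l_eq ler10.
  have lnBn : ln (B k) <= ln n%:R by rewrite ler_ln ?posrE// (lt_le_trans _ n1).
  by rewrite ler_ln ?posrE// (lt_le_trans lnB).
split.
  by apply: (le_trans h1); rewrite ler_wpM2l// addr_ge0// ltW.
by move=> /h2 h3; apply: (le_trans h3); rewrite ler_wpM2l// ltW.
Qed.

End block.

(** * Kernel averages as integrals of the empirical distribution function *)

Section kernel_integrals.
Context {R : realType}.
Local Notation mu := (@lebesgue_measure R).
Implicit Types (k g : R -> R).

Lemma integrable_mul_bounded k g M : mu.-integrable setT (EFin \o k) ->
  measurable_fun setT g -> (forall v, k v != 0 -> `|g v| <= M) ->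
  mu.-integrable setT (EFin \o (fun v => k v * g v)).
Proof.
move=> ik mg gM; have mk : measurable_fun setT k.
  by apply/measurable_EFinP; exact: measurable_int ik.
apply: (le_integrable _ _ _ (integrableZl measurableT M ik)) => //.
  by apply/measurable_EFinP; exact: measurable_funM.
move=> v _ /=; rewrite lee_fin !normrM mulrC.
have [->|kv] := eqVneq (k v) 0; first by rewrite normr0 !mulr0.
by rewrite ler_wpM2r// (le_trans (gM _ kv))// ler_norm.
Qed.

Lemma Rintegral_sum n (g : nat -> R -> R) :
  (forall i, mu.-integrable setT (EFin \o g i)) ->
  mu.-integrable setT (EFin \o (fun v => \sum_(i < n) g i v)) /\
  \int[mu]_v (\sum_(i < n) g i v) = \sum_(i < n) \int[mu]_v g i v.
Proof.
move=> ig; elim: n => [|n [ih1 ih2]].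
  have -> : (fun v => \sum_(i < 0) g i v) = cst 0.
    by apply/funext => v; rewrite big_ord0.
  split; first exact: integrable0.
  by rewrite Rintegral_cst// mul0r big_ord0.
have -> : (fun v => \sum_(i < n.+1) g i v) =
    (fun v => \sum_(i < n) g i v + g n v).
  by apply/funext => v; rewrite big_ord_recr.
split; first exact: (integrableD measurableT ih1 (ig n)).
by rewrite RintegralD// ih2 big_ord_recr.
Qed.

Lemma integrable_comp_opp k : mu.-integrable setT (EFin \o k) ->
  mu.-integrable setT (EFin \o (fun v => k (- v))) /\
  \int[mu]_v k (- v) = \int[mu]_v k v.
Proof.
move=> ik; have mk : measurable_fun setT (EFin \o k) by exact: measurable_int ik.
have pE (g : R -> \bar R) :
    (\int[pushforward mu (-%R : _ -> measurableTypeR R)]_y g y = \int[mu]_y g y)%E.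
  by apply: eq_measure_integral => A mA _; exact: lebesgue_measureN.
have ikN : mu.-integrable setT (EFin \o (fun v => k (- v))).
  apply/integrableP; split.
    by apply: (measurableT_comp mk).
  move/integrableP : ik => [_]; rewrite -pE ge0_integral_pushforward//.
  exact: measurableT_comp.
split => //; rewrite /Rintegral; congr fine.
by rewrite -[RHS]pE integral_pushforward.
Qed.

(** [v <= (x - z) / h] iff [z <= x - h v], so the average integrates [k v] against the empirical
    distribution function at [x - h v]. The affine comparison function integrates exactly to the two
    moments, and the remainder costs [M] times the absolute mass. *)
Lemma kernel_sum_affine k (z : nat -> R) n x h p q M C :
  mu.-integrable setT (EFin \o k) -> (forall v, k v != 0 -> `|v| <= 1) ->
  \int[mu]_v `|k v| <= C -> 0 < h -> 0 <= M ->
  (forall v, k v != 0 ->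
    `|n%:R^-1 * \sum_(i < n) \1_(`]-oo, x - h * v]) (z i) - (p - q * v)| <= M) ->
  `|n%:R^-1 * \sum_(i < n) int_kernel k ((x - z i) / h) -
    (p * \int[mu]_v k v - q * \int[mu]_v (v * k v))| <= M * C.
Proof.
move=> ik k1 kC h0 M0 kM.
have mk : measurable_fun setT k.
  by apply/measurable_EFinP; exact: measurable_int ik.
have iN k1' : mu.-integrable setT (EFin \o k1') ->
    mu.-integrable setT (EFin \o (fun v => `|k1' v|)).
  by move=> /integrable_abse; exact.
pose H i v : R := \1_(`]-oo, x - h * v]) (z i).
have HE i v : H i v = \1_(`]-oo, (x - z i) / h]) v.
  rewrite /H !indicE; congr ((_ : bool)%:R).
  apply/idP/idP; rewrite !inE /= !in_itv/= ler_pdivlMr//; lra.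
have mH i : measurable_fun setT (H i).
  rewrite (_ : H i = \1_(`]-oo, (x - z i) / h])); last by apply/funext => v; rewrite HE.
  exact: measurable_indic.
have H1 i v : `|H i v| <= 1.
  by rewrite /H indicE; case: (_ \in _); rewrite ?normr1 ?normr0.
have ikH i : mu.-integrable setT (EFin \o (fun v => k v * H i v)).
  by apply: (integrable_mul_bounded ik (mH i)) => v _; exact: H1.
have intE i : int_kernel k ((x - z i) / h) = \int[mu]_v (k v * H i v).
  rewrite /int_kernel Rintegral_mkcond; congr Rintegral.
  by rewrite patch_indic; apply/funext => v; rewrite /= HE.
have [iS SE] := Rintegral_sum n ikH.
have ivk : mu.-integrable setT (EFin \o (fun v => v * k v)).
  rewrite (_ : (fun v => v * k v) = (fun v => k v * v)); last first.
    by apply/funext => v; rewrite mulrC.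
  by apply: (@integrable_mul_bounded _ _ 1 ik) => //; exact: measurable_id.
pose G v := n%:R^-1 * (\sum_(i < n) (k v * H i v)) - (p * k v - q * (v * k v)).
have i1 : mu.-integrable setT (EFin \o (fun v => n%:R^-1 * (\sum_(i < n) (k v * H i v)))).
  exact: (integrableZl measurableT (n%:R^-1) iS).
have i2 : mu.-integrable setT (EFin \o (fun v => p * k v)).
  exact: (integrableZl measurableT p ik).
have i3 : mu.-integrable setT (EFin \o (fun v => q * (v * k v))).
  exact: (integrableZl measurableT q ivk).
have i4 : mu.-integrable setT (EFin \o (fun v => p * k v - q * (v * k v))).
  exact: (integrableB measurableT i2 i3).
have iG : mu.-integrable setT (EFin \o G).
  exact: (integrableB measurableT i1 i4).
have -> : n%:R^-1 * \sum_(i < n) int_kernel k ((x - z i) / h) -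
    (p * \int[mu]_v k v - q * \int[mu]_v (v * k v)) = \int[mu]_v G v.
  rewrite /G RintegralB// RintegralB// !RintegralZl// SE.
  by congr (_ * _ - _); apply: eq_bigr => i _; rewrite intE.
apply: le_trans (le_normr_Rintegral measurableT iG) _.
apply: (@le_trans _ _ (\int[mu]_v (M * `|k v|))).
  apply: le_Rintegral => //; first exact: iN.
    exact: (integrableZl measurableT M (iN _ ik)).
  move=> v _; have -> : G v = k v *
      (n%:R^-1 * \sum_(i < n) H i v - (p - q * v)).
    by rewrite /G -mulr_sumr; ring.
  have [->|kv] := eqVneq (k v) 0; first by rewrite !mul0r normr0 mulr0.
  by rewrite normrM mulrC ler_wpM2r// kM.
rewrite RintegralZl//; last exact: iN.
exact: ler_wpM2l.
Qed.

End kernel_integrals.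

(** * Deterministic error bound in the three regions *)

Section estimator_error.
Context {R : realType}.
Local Notation mu := (@lebesgue_measure R).
Variables (a b : R) (K : R -> R) (KL : R -> R -> R) (C : R).
Hypotheses (ab : a < b) (K_kernel : kernel_density K)
  (KL_kernel : left_boundary_kernel KL)
  (KL_C : forall alpha, 0 < alpha < 1 -> \int[mu]_v `|KL alpha v| <= C).

Lemma kernel_density_integrable : mu.-integrable setT (EFin \o K).
Proof.
have [[mK K0 K1] _] := K_kernel.
apply/integrableP; split; first exact/measurable_EFinP.
under eq_integral do rewrite /= ger0_norm//.
by rewrite K1 ltry.
Qed.

Lemma kernel_density_support v : K v != 0 -> `|v| <= 1.
Proof.
have [_ [_ _ suppK]] := K_kernel => Kv.
have : closed_support K v by exact: subset_closure.
by rewrite suppK /= in_itv/= ler_norml.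
Qed.

Lemma kernel_density_Rintegral : \int[mu]_v K v = 1.
Proof. by have [[_ _ K1] _] := K_kernel; rewrite /Rintegral K1. Qed.

Lemma kernel_density_mean : \int[mu]_v (v * K v) = 0.
Proof.
have [_ [_ Ksym _]] := K_kernel.
have iv : mu.-integrable setT (EFin \o (fun v => v * K v)).
  rewrite (_ : (fun v => v * K v) = (fun v => K v * v)); last first.
    by apply/funext => v; rewrite mulrC.
  apply: (@integrable_mul_bounded _ _ _ 1 kernel_density_integrable) => //.
  exact: kernel_density_support.
have [_] := integrable_comp_opp iv.
under eq_Rintegral do rewrite Ksym mulNr -mulN1r.
by rewrite RintegralZl// => h; lra.
Qed.

Lemma left_kernel_support alpha v : 0 < alpha < 1 -> KL alpha v != 0 ->
  -1 <= v <= alpha.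
Proof.
move=> /KL_kernel[supp _] kv.
have /supp : closed_support (KL alpha) v by exact: subset_closure.
by rewrite /= in_itv.
Qed.

Lemma left_kernel_integrable alpha : 0 < alpha < 1 ->
  mu.-integrable setT (EFin \o KL alpha).
Proof. by move=> /KL_kernel[]. Qed.

Lemma moment0E alpha : moment KL 0 alpha = \int[mu]_v KL alpha v.
Proof. by apply: eq_Rintegral => v _; rewrite expr0 mul1r. Qed.

Lemma moment1E alpha : moment KL 1 alpha = \int[mu]_v (v * KL alpha v).
Proof. by apply: eq_Rintegral => v _; rewrite expr1. Qed.

(** The tail is total mass minus cumulative integral, and reflection preserves the mass: the right
    boundary takes the form constant plus [int_kernel]. *)
Lemma int_right_kernelE alpha u : 0 < alpha < 1 ->
  int_right_kernel KL alpha u =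
  1 - moment KL 0 alpha + int_kernel (right_kernel KL alpha) u.
Proof.
move=> al; have [ikR mR] := integrable_comp_opp (left_kernel_integrable al).
rewrite /int_right_kernel /int_kernel -Rintegral_itv_obnd_cbnd; last first.
  exact: integrableS ikR.
have := @Rintegral_itvB _ (right_kernel KL alpha) -oo%O +oo%O u.
rewrite set_itvNyy => /(_ ikR isT isT) <-.
by rewrite mR moment0E; lra.
Qed.

Variable F : R -> R.
Hypotheses (Fa : forall x, x <= a -> F x = 0) (Fb : forall x, b <= x -> F x = 1).

(* [D = 0] makes [omega] a modulus of continuity of [F]; [D = F'] makes it a
   Taylor remainder, and the moment condition then cancels the linear term. *)
Lemma boundary_estimator_error (z : nat -> R) (n : nat) (h : R) (D : R -> R)
    (omega S Sloc M : R) :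
  (0 < n)%N -> 0 < h <= (b - a) / 2 ->
  (forall x y, a <= x <= b -> a <= y <= b -> `|y - x| <= 2 * h ->
    `|F y - F x - D x * (y - x)| <= omega) ->
  (forall alpha, 0 < alpha < 1 ->
    D a * (alpha * (1 - moment KL 0 alpha) + moment KL 1 alpha) = 0 /\
    D b * (alpha * (1 - moment KL 0 alpha) + moment KL 1 alpha) = 0) ->
  (forall t, `|n%:R^-1 * \sum_(i < n) \1_(`]-oo, t]) (z i) - F t| <= S) ->
  (forall t, t <= a + 2 * h \/ b - 2 * h <= t ->
    `|n%:R^-1 * \sum_(i < n) \1_(`]-oo, t]) (z i) - F t| <= Sloc) ->
  S <= M -> C * Sloc <= M ->
  forall x, `|boundary_estimator a b K KL h n z x - F x| <= M + (C + 1) * omega.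
Proof.
move=> n0 /andP[h0 hab] FD Dmom hS hSloc SM SlocM x.
have np : 0 < n%:R :> R by rewrite ltr0n.
have S0 : 0 <= S by exact: le_trans (normr_ge0 _) (hS 0).
have Sloc0 : 0 <= Sloc.
  by apply: le_trans (normr_ge0 _) (hSloc a _); left; lra.
have C0 : 0 <= C.
  apply: (le_trans _ (KL_C (alpha := 1 / 2) _)); last by lra.
  by apply: Rintegral_ge0.
have om0 : 0 <= omega.
  by apply: le_trans (normr_ge0 _) (FD a a _ _ _); rewrite ?lexx ?ltW ?subrr ?normr0//; lra.
have res0 : 0 <= M + (C + 1) * omega.
  by rewrite addr_ge0 ?mulr_ge0 ?addr_ge0// (le_trans S0).
rewrite /boundary_estimator; case: ifPn => [xa|].
  by rewrite (Fa xa) subrr normr0.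
rewrite -ltNge => ax; case: ifPn => [bx|].
  by rewrite (Fb bx) subrr normr0.
rewrite -ltNge => xb.
have F_a : F a = 0 by exact: Fa.
have F_b : F b = 1 by exact: Fb.
rewrite /modified_int_kernel; have [xah|ahx] := ltP x (a + h).
  pose al := (x - a) / h.
  have al01 : 0 < al < 1.
    by rewrite /al divr_gt0 ?subr_gt0// ltr_pdivrMr// mul1r; lra.
  have xE : x - a = al * h by rewrite /al divfK// gt_eqF.
  have supp v : KL al v != 0 -> -1 <= v <= al by exact: left_kernel_support.
  (* Expansion at [a]: on the kernel support [x - h v] lies in [[a, a + 2 h]], where [F (x - h v)]
     is close to [D a (x - a) - D a h v]. This costs [C * omega], and replacing [D a (x - a)] by
     [F x] costs one more [omega], whence [C + 1]. *)
  have := @kernel_sum_affine _ (KL al) z n x h (D a * (x - a)) (D a * h) (Sloc + omega) C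
    (left_kernel_integrable al01) _ (KL_C al01) h0 _ _.
  rewrite -moment0E -moment1E.
  have -> : D a * (x - a) * moment KL 0 al - D a * h * moment KL 1 al =
      D a * (x - a).
    have [h1 _] := Dmom _ al01.
    have -> : D a * (x - a) * moment KL 0 al - D a * h * moment KL 1 al =
        D a * (x - a) -
        h * (D a * (al * (1 - moment KL 0 al) + moment KL 1 al)).
      by rewrite xE; ring.
    by rewrite h1 mulr0 subr0.
  rewrite -/(int_left_kernel KL al _) => main.
  have hx : `|F x - F a - D a * (x - a)| <= omega by apply: FD; rewrite ?ler_norml; lra.
  move: main; move: (n%:R^-1 * _) => E main.
  have {main} : `|E - D a * (x - a)| <= (Sloc + omega) * C.
    apply: main => [v /supp||v /supp]; rewrite ?addr_ge0//.
      by rewrite ler_norml; lra.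
    move=> /andP[v1 v2].
    have hv1 : - h <= h * v by nra.
    have hv2 : h * v <= al * h by rewrite mulrC ler_wpM2r// ltW.
    have t1 : a <= x - h * v by lra.
    have t2 : x - h * v <= a + 2 * h by lra.
    have := hSloc (x - h * v) (or_introl t2).
    have : `|F (x - h * v) - F a - D a * (x - h * v - a)| <= omega.
      by apply: FD; rewrite ?ler_norml; lra.
    rewrite F_a !ler_norml; lra.
  move: hx; rewrite F_a !ler_norml; lra.
have [xbh|bhx] := leP x (b - h).
  (* In the interior the expansion is at [x], and the zero mean of [K] removes the linear term
     whatever [D x] is. *)
  have := @kernel_sum_affine _ K z n x h (F x) (D x * h) (S + omega) 1
    kernel_density_integrable kernel_density_support _ h0 _ _.
  rewrite kernel_density_Rintegral kernel_density_mean mulr1 mulr0 subr0.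
  move: (n%:R^-1 * _) => E main.
  have {main} : `|E - F x| <= (S + omega) * 1.
    apply: main => [||v /kernel_density_support]; rewrite ?addr_ge0//.
      have [[_ K0 _] _] := K_kernel.
      by under eq_Rintegral do rewrite ger0_norm//; rewrite kernel_density_Rintegral.
    rewrite ler_norml => /andP[v1 v2].
    have hv1 : - h <= h * v by nra.
    have hv2 : h * v <= h by nra.
    have := hS (x - h * v).
    have : `|F (x - h * v) - F x - D x * (x - h * v - x)| <= omega.
      by apply: FD; rewrite ?ler_norml; lra.
    rewrite !ler_norml; lra.
  have : 0 <= C * omega by rewrite mulr_ge0.
  rewrite !ler_norml; lra.
pose al := (b - x) / h.
have al01 : 0 < al < 1.
  by rewrite /al divr_gt0 ?subr_gt0// ltr_pdivrMr// mul1r; lra.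
have xE : b - x = al * h by rewrite /al divfK// gt_eqF.
have [ikR mR] := integrable_comp_opp (left_kernel_integrable al01).
have supp v : right_kernel KL al v != 0 -> - al <= v <= 1.
  by move=> /(left_kernel_support al01); lra.
have iabs : mu.-integrable setT (EFin \o (fun v => `|KL al v|)).
  by have /integrable_abse := left_kernel_integrable al01.
have [_ absR] := integrable_comp_opp iabs.
have ivk : mu.-integrable setT (EFin \o (fun v => v * KL al v)).
  rewrite (_ : (fun v => v * KL al v) = (fun v => KL al v * v)); last first.
    by apply/funext => v; rewrite mulrC.
  apply: (@integrable_mul_bounded _ _ _ 1 (left_kernel_integrable al01)) => // v.
  by move=> /(left_kernel_support al01); rewrite ler_norml; lra.
have [ivR vR] := integrable_comp_opp ivk.
have m1R : \int[mu]_v (v * right_kernel KL al v) = - moment KL 1 al.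
  rewrite moment1E -vR -mulN1r -RintegralZl//.
  by apply: eq_Rintegral => v _; rewrite /right_kernel; ring.
(* Expansion at [b]; the mass defect in the constant term is restored by the [1 - moment KL 0 al] of
   [int_right_kernelE]. *)
have := @kernel_sum_affine _ (right_kernel KL al) z n x h
  (1 - D b * (b - x)) (D b * h) (Sloc + omega) C ikR _ _ h0 _ _.
rewrite m1R (_ : \int[mu]_v right_kernel KL al v = moment KL 0 al); last first.
  by rewrite moment0E -mR.
have -> : (1 - D b * (b - x)) * moment KL 0 al - D b * h * - moment KL 1 al =
    moment KL 0 al - D b * (b - x).
  have [_ h1] := Dmom _ al01.
  have -> : (1 - D b * (b - x)) * moment KL 0 al - D b * h * - moment KL 1 al =
      moment KL 0 al - D b * (b - x) +
      h * (D b * (al * (1 - moment KL 0 al) + moment KL 1 al)).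
    by rewrite xE; ring.
  by rewrite h1 mulr0 addr0.
have -> : n%:R^-1 * \sum_(i < n) int_right_kernel KL ((b - x) / h) ((x - z i) / h) =
    1 - moment KL 0 al + n%:R^-1 *
      \sum_(i < n) int_kernel (right_kernel KL al) ((x - z i) / h).
  under eq_bigr do rewrite int_right_kernelE//.
  rewrite big_split/= sumr_const card_ord mulrDr -[X in n%:R^-1 * X + _]mulr_natl mulrA.
  by rewrite mulVf ?mul1r// gt_eqF.
move: (n%:R^-1 * _) => E main.
have hx : `|F x - F b - D b * (x - b)| <= omega by apply: FD; rewrite ?ler_norml; lra.
have {main} : `|E - (moment KL 0 al - D b * (b - x))| <= (Sloc + omega) * C.
  apply: main => [v /supp|||v /supp]; rewrite ?addr_ge0//.
  - by rewrite ler_norml; lra.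
  - by rewrite absR; exact: KL_C.
  move=> /andP[v1 v2].
  have hv1 : h * v <= h by nra.
  have hv2 : - (al * h) <= h * v by rewrite mulrC -mulrN ler_wpM2l// ltW.
  have t1 : x - h * v <= b by lra.
  have t2 : b - 2 * h <= x - h * v by lra.
  have := hSloc (x - h * v) (or_intror t2).
  have : `|F (x - h * v) - F b - D b * (x - h * v - b)| <= omega.
    by apply: FD; rewrite ?ler_norml; lra.
  rewrite F_b !ler_norml; lra.
move: hx; rewrite F_b !ler_norml; lra.
Qed.

End estimator_error.

(** * Taylor remainder under a Lipschitz derivative *)

Section taylor.
Context {R : realType}.
Variables (F F' : R -> R) (a b L : R).
Hypotheses
  (F_derivative : forall x, a <= x <= b -> has_derivative_within `[a, b] F x (F' x))
  (F_continuous : continuous F)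
  (F'_lipschitz : forall x y, a <= x <= b -> a <= y <= b ->
     `|F' x - F' y| <= L * `|x - y|).

Lemma is_derive_within_itv x : a < x < b -> is_derive x 1 F (F' x).
Proof.
move=> /andP[ax xb].
have Fx : has_derivative_within `[a, b] F x (F' x) by apply: F_derivative; rewrite !ltW.
have cvg : h^-1 *: (F (h *: 1 + x) - F x) @[h --> 0^'] --> F' x.
  apply/cvgrPdist_lt => e e0.
  have /cvgrPdist_lt/(_ e e0) := Fx.
  rewrite near_withinE => -[r /= r0 hr].
  exists (Num.min r (Num.min (x - a) (b - x))) => /=.
    by rewrite !lt_min r0 !subr_gt0 ax xb.
  move=> h /=; rewrite sub0r normrN !lt_min => /and3P[hr' ha hb] h0.
  have hball : ball_ Num.norm x r (h + x).
    by rewrite /ball_/= opprD addrCA subrr addr0 normrN.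
  have -> : h *: 1 + x = h + x by rewrite /GRing.scale/= mulr1.
  have hx : h + x != x by rewrite -subr_eq0 addrK.
  have hab : h + x \in `[a, b].
    rewrite in_itv/=; move: ha hb; rewrite !ltr_norml; lra.
  have := hr _ hball hx hab; rewrite addrK.
  by rewrite /GRing.scale/= mulrC.
by split; [exact: cvgP cvg|exact: cvg_lim cvg].
Qed.

(** The mean value theorem gives [c] between [x] and [y], and [F' c - F' x] is Lipschitz-small. The
    theorem asks for derivatives at inner points only, so [x] and [y] may be endpoints. *)
Lemma taylor_remainder x y : a <= x <= b -> a <= y <= b ->
  `|F y - F x - F' x * (y - x)| <= L * `|y - x| ^+ 2.
Proof.
have mvt u v : a <= u <= b -> a <= v <= b -> u < v ->
    exists2 c, u < c < v & F v - F u = F' c * (v - u).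
  move=> /andP[au ub] /andP[av vb] uv.
  have [||c cuv E] := @MVT _ F F' u v uv.
  - move=> z; rewrite in_itv/= => /andP[z1 z2]; apply: is_derive_within_itv.
    by rewrite (le_lt_trans au)//= (lt_le_trans z2).
  - exact: continuous_subspaceT.
  by exists c; rewrite ?E//; move: cuv; rewrite in_itv.
move=> xab yab; have [xy|yx|<-] := ltgtP x y; last first.
- by rewrite !subrr mulr0 subrr normr0 expr0n mulr0.
- have [c cxy E] := mvt _ _ yab xab yx.
  have -> : F y - F x - F' x * (y - x) = (F' x - F' c) * (x - y).
    by rewrite -(opprB (F x)) E; ring.
  have cab : a <= c <= b by lra.
  rewrite normrM -(distrC x) expr2 mulrA ler_wpM2r//.
  apply: (le_trans (F'_lipschitz xab cab)).
  have L0 : 0 <= L.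
    have := le_trans (normr_ge0 _) (F'_lipschitz xab cab).
    by rewrite pmulr_lge0// normr_gt0 subr_eq0 gt_eqF//; lra.
  by rewrite ler_wpM2l// !ger0_norm; lra.
have [c cxy E] := mvt _ _ xab yab xy.
have -> : F y - F x - F' x * (y - x) = (F' c - F' x) * (y - x) by rewrite E; ring.
have cab : a <= c <= b by lra.
rewrite normrM expr2 mulrA ler_wpM2r//.
apply: (le_trans (F'_lipschitz cab xab)).
have L0 : 0 <= L.
  have := le_trans (normr_ge0 _) (F'_lipschitz cab xab).
  by rewrite pmulr_lge0// normr_gt0 subr_eq0 gt_eqF//; lra.
by rewrite ler_wpM2l// !ger0_norm; lra.
Qed.

End taylor.

(** * Measurability of an uncountable supremum *)

Section measurable_supremum.
Context {d : measure_display} {T : measurableType d} {R : realType}.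
Variables (P : probability T R) (X : nat -> {RV P >-> R}).

(* A supremum of uncountably many continuous functions of [X_0, ..., X_(n-1)] is
   lower semicontinuous in them: its strict superlevel sets are countable unions
   of rational boxes. *)
Lemma measurable_sup_continuous_sum (I : Type) (c : I -> R) (m : R)
    (psi : I -> R -> R) n :
  (forall x, continuous (psi x)) ->
  measurable_fun setT (fun w =>
    ereal_sup (range (fun x => `|c x + m * \sum_(i < n) psi x (X i w)|%:E))).
Proof.
move=> psi_cont _.
apply: (measurability _ (ErealGenOInfty.measurableE R)) => // _ [_ [r ->] <-].
rewrite setTI.
pose val x (z : 'I_n -> R) := `|c x + m * \sum_(i < n) psi x (z i)|.
pose inside (q : {ffun 'I_n -> rat * rat}) (z : 'I_n -> R) :=
  forall i, `|z i - ratr (q i).1| < ratr (q i).2.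
pose good q := exists x, forall z, inside q z -> r < val x z.
pose box q := [set w | good q /\ inside q (fun i => X i w)].
rewrite (_ : _ @^-1` _ = \bigcup_q box q).
  apply: countable_bigcupT_measurable; first exact: countableP.
  move=> q; have [gq|gq] := pselect (good q); last first.
    by rewrite (_ : box q = set0)// -subset0 => w [].
  rewrite (_ : box q = \bigcap_(i in [set: 'I_n]) (X i) @^-1`
      [set y | `|y - ratr (q i).1| < ratr (q i).2]); last first.
    by apply/seteqP; split=> [w [_ h] i _|w h]; [exact: h|split=> // i; exact: h].
  apply: fin_bigcap_measurable => [|i _]; first exact: finite_finset.
  apply: measurable_funPTI; apply: open_measurable.
  rewrite (_ : [set _ | _] = ball (ratr (q i).1 : R) (ratr (q i).2)).
    exact: ball_open.
  by apply/seteqP; split => y /=; rewrite /ball/= distrC.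
apply/seteqP; split => w /=; last first.
  move=> [q _ [[x hx] hq]]; rewrite in_itv/= andbT.
  apply: (@lt_le_trans _ _ (val x (fun i => X i w))%:E).
    by rewrite lte_fin; exact: hx.
  by apply: ereal_sup_ubound; exists x.
rewrite in_itv/= andbT => /ereal_sup_gt[_ [x _ <-]]; rewrite lte_fin => rx.
have [e e0 he] : exists2 e, 0 < e & forall z : 'I_n -> R,
    (forall i, `|psi x (z i) - psi x (X i w)| < e) -> r < val x z.
  pose eta := val x (fun i => X i w) - r.
  have eta0 : 0 < eta by rewrite subr_gt0.
  exists (eta / (`|m| * n%:R + 1)); first by rewrite divr_gt0// ltr_wpDl// mulr_ge0.
  move=> z hz.
  have : `|val x z - val x (fun i => X i w)| < eta.
    apply: (le_lt_trans (ler_dist_dist _ _)).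
    rewrite opprD addrACA subrr add0r -mulrBr -sumrB normrM.
    apply: (@le_lt_trans _ _ (`|m| * (n%:R * (eta / (`|m| * n%:R + 1))))).
      rewrite ler_wpM2l//; apply: (le_trans (ler_norm_sum _ _ _)).
      have -> (B : R) : n%:R * B = \sum_(i < n) B.
        by rewrite sumr_const card_ord mulr_natl.
      by apply: ler_sum => i _; exact: ltW.
    rewrite mulrA mulrA ltr_pdivrMr ?ltr_wpDl ?mulr_ge0//.
    by rewrite mulrC ltr_pM2l// ltrDl.
  rewrite ltr_norml /eta; lra.
have /choice[q hq] : forall i : 'I_n, exists q : rat * rat,
    `|X i w - ratr q.1| < ratr q.2 /\
    forall y, `|y - ratr q.1| < ratr q.2 -> `|psi x y - psi x (X i w)| < e.
  move=> i; have /cvgrPdist_lt/(_ e e0) := psi_cont x (X i w).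
  move=> -[t /= t0 ht].
  (* A centre within [t / 3] of [X i w] and a radius between [t / 3] and [t / 2]: the ball contains
     [X i w] and stays within [t] of it. *)
  have [q1 hq1] := @rat_in_itvoo R (X i w - t / 3) (X i w + t / 3) ltac:(lra).
  have [q2 hq2] := @rat_in_itvoo R (t / 3) (t / 2) ltac:(lra).
  move: hq1 hq2; rewrite !in_itv/= => hq1 hq2.
  exists (q1, q2) => /=; split; first by rewrite ltr_norml; lra.
  move=> y hy; rewrite distrC; apply: ht; rewrite /ball_/= ltr_norml.
  by move: hy; rewrite ltr_norml; lra.
exists (finfun q) => //; split; last by move=> i; rewrite ffunE; exact: (hq i).1.
exists x => z hz; apply: he => i; apply: (hq i).2.
by have := hz i; rewrite ffunE.
Qed.

End measurable_supremum.

Lemma limn_esup_le_near {R : realType} (u : nat -> \bar R) (l : \bar R) :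
  (\forall n \near \oo, (u n <= l)%E) -> (limn_esup u <= l)%E.
Proof.
move=> ul; rewrite /limn_esup /limf_esup.
apply: (@le_trans _ _ (ereal_sup (u @` [set n | (u n <= l)%E]))).
  by apply: ereal_inf_lbound; exists [set n | (u n <= l)%E].
by apply: ge_ereal_sup => _ [n /= un <-].
Qed.

Lemma nneseries_lty_le {R : realType} (u v : nat -> \bar R) m n0 :
  (forall k, (m <= k)%N -> (0 <= u k < +oo)%E) -> (forall k, 0 <= v k)%E ->
  (forall k, (m <= k)%N -> (n0 <= k)%N -> (u k <= v k)%E) ->
  (\sum_(0 <= k <oo) v k < +oo)%E -> (\sum_(m <= k <oo) u k < +oo)%E.
Proof.
move=> u0 v0 uv vlt.
have uk0 k : (m <= k)%N -> (0 <= u k)%E by move=> /u0/andP[].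
rewrite (nneseries_split m n0)// lte_add_pinfty//.
  rewrite big_nat_cond; apply: lte_sum_pinfty => i /andP[/andP[/u0/andP[_ ui] _] _].
  exact: ui.
apply: le_lt_trans vlt.
rewrite (nneseries_split 0 (m + n0) (f := v)); last by move=> k _; exact: v0.
apply: (@le_trans _ _ (\sum_(m + n0 <= k <oo) v k)%E); last first.
  by rewrite add0n leeDr// sume_ge0.
apply: lime_le.
  apply: is_cvg_nneseries => k mk _; apply: uk0.
  by rewrite (leq_trans _ mk)// leq_addr.
apply: nearW => k; apply: le_trans (nneseries_lim_ge _ _); last by move=> *; exact: v0.
rewrite big_nat_cond [leRHS]big_nat_cond; apply: lee_sum => i /andP[/andP[mi _] _].
by apply: uv; rewrite (leq_trans _ mi)// ?leq_addl ?leq_addr.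
Qed.

(** * Consistency and the Chung-Smirnov property *)

Section consistency.
Context {R : realType} {d : measure_display} {T : measurableType d}.
Variables (P : probability T R) (X : nat -> {RV P >-> R}) (f : R -> R) (a b : R).
Variables (K : R -> R) (KL : R -> R -> R) (h : nat -> R) (C : R).
Hypotheses (ab : a < b) (X_indep : mutually_independent X)
  (X_density : forall i, has_density (X i) f)
  (f_support : closed_support f = `[a, b]%classic)
  (K_kernel : kernel_density K) (KL_kernel : left_boundary_kernel KL)
  (h_range : forall n, (0 < n)%N -> 0 < h n <= (b - a) / 2)
  (h_cvg0 : h n @[n --> \oo] --> (0 : R))
  (C0 : 0 <= C)
  (KL_C : forall alpha, 0 < alpha < 1 ->
    \int[@lebesgue_measure R]_v `|KL alpha v| <= C).
Local Notation F := (distribution_function (X 0%N)).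
Local Notation Ftilde n w := (boundary_estimator a b K KL (h n) n (fun i => X i w)).

Let F_nondecreasing : {homo F : x y / x <= y}.
Proof. exact: distribution_function_nondecreasing. Qed.

Let F01 x : 0 <= F x <= 1.
Proof. exact: distribution_function_ge0_le1. Qed.

Let F_left x : x <= a -> F x = 0.
Proof. exact: distribution_function_left (X_density 0) f_support x. Qed.

Let F_right x : b <= x -> F x = 1.
Proof. exact: distribution_function_right (X_density 0) f_support x. Qed.

Let mF r : measurable [set x | F x < r].
Proof. exact: measurable_distribution_lt. Qed.

(** The common density makes the variables identically distributed, so [F], defined from [X 0],
    serves for every [X i]. *)
Let PF i r : 0 <= r <= 1 -> P (X i @^-1` [set x | F x < r]) = r%:E.
Proof.
move=> r01; have <- := probability_distribution_lt ab (X_density 0) f_support r01.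
have [_ _ E0] := X_density 0; have [_ _ Ei] := X_density i.
have := E0 _ (mF r); rewrite -(Ei _ (mF r)).
by rewrite /distribution /pushforward.
Qed.

Let F_unif e : 0 < e -> exists2 r, 0 < r &
  forall u v, `|v - u| < r -> `|F v - F u| < e.
Proof. exact: distribution_function_unif_continuous (X_density 0) e. Qed.

Let h_lt r : 0 < r -> exists n0, forall n, (n0 <= n)%N -> (0 < n)%N -> 2 * h n < r.
Proof.
move=> r0; have r2 : 0 < r / 2 by rewrite divr_gt0.
have /cvgrPdist_lt/(_ _ r2)[n0 _ hn0] := h_cvg0.
exists n0 => n n0n n_gt0; have := hn0 n n0n.
by rewrite /= sub0r normrN ltr_norml; lra.
Qed.

Lemma empirical_deviationE n w t : (0 < n)%N ->
  `|n%:R^-1 * \sum_(i < n) \1_(`]-oo, t]) (X i w) - F t| =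
  `|deviation X `]-oo, t] (F t) n w| / n%:R.
Proof.
move=> n0; have np : 0 < n%:R :> R by rewrite ltr0n.
rewrite -[X in _ / X](ger0_norm (ltW np)) -normrV ?unitfE ?gt_eqF// -normrM.
rewrite /deviation sumrB sumr_const card_ord mulrBl.
by rewrite -[F t *+ n]mulr_natr mulfK ?gt_eqF// [X in _ = `|X - _|]mulrC.
Qed.

Lemma sup_norm_le (g : R -> R) c : (forall x, `|g x| <= c) ->
  (sup_norm g <= c%:E)%E.
Proof. by move=> gc; apply: ge_ereal_sup => _ [x _ <-]; rewrite lee_fin. Qed.

Lemma modified_int_kernel_continuous n x : (0 < n)%N -> a < x < b ->
  continuous (modified_int_kernel a b K KL (h n) x).
Proof.
move=> /h_range /andP[h0 hab] /andP[ax xb]; rewrite /modified_int_kernel => u.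
case: ltP => xah.
  have al01 : 0 < (x - a) / h n < 1.
    by rewrite divr_gt0 ?subr_gt0// ltr_pdivrMr// mul1r; lra.
  exact: int_kernel_continuous (left_kernel_integrable KL_kernel al01) u.
case: leP => xbh.
  exact: int_kernel_continuous (kernel_density_integrable K_kernel) u.
have al01 : 0 < (b - x) / h n < 1.
  by rewrite divr_gt0 ?subr_gt0// ltr_pdivrMr// mul1r; lra.
have [ikR _] := integrable_comp_opp (left_kernel_integrable KL_kernel al01).
rewrite (_ : (fun _ => _) = (fun u => 1 - moment KL 0 ((b - x) / h n) +
    int_kernel (right_kernel KL ((b - x) / h n)) u)); last first.
  by apply/funext => v; rewrite (int_right_kernelE KL_kernel).
by apply: cvgD; [exact: cvg_cst|exact: int_kernel_continuous].
Qed.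

Lemma measurable_sup_norm_error n : (0 < n)%N ->
  measurable_fun setT (fun w => sup_norm (fun x => Ftilde n w x - F x)).
Proof.
move=> n0.
(* Outside []a, b[] the estimator does not depend on the sample; its value goes into [c] and [psi]
   is 0, so [psi x] is continuous for every [x]. *)
pose c x : R := (if x <= a then 0 else if b <= x then 1 else 0) - F x.
pose psi x z : R := if (x <= a) || (b <= x) then 0 else
  modified_int_kernel a b K KL (h n) x ((x - z) / h n).
rewrite (_ : (fun _ => _) = (fun w => ereal_sup (range (fun x =>
    `|c x + n%:R^-1 * \sum_(i < n) psi x (X i w)|%:E)))).
  apply: measurable_sup_continuous_sum => x.
  have [xab|xab] := boolP ((x <= a) || (b <= x)).
    rewrite (_ : psi x = cst 0); last by apply/funext => z; rewrite /psi xab.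
    by move=> z; exact: cvg_cst.
  rewrite (_ : psi x = fun z => modified_int_kernel a b K KL (h n) x ((x - z) / h n)).
    move: xab; rewrite negb_or -!ltNge => xab z.
    apply: (@continuous_comp _ _ _ (fun z => (x - z) / h n)
      (modified_int_kernel a b K KL (h n) x)).
      2: exact: modified_int_kernel_continuous.
    apply: cvgM; last exact: cvg_cst.
    by apply: cvgB; [exact: cvg_cst|exact: cvg_id].
  by apply/funext => z; rewrite /psi (negbTE xab).
apply/funext => w; rewrite /sup_norm; congr ereal_sup.
apply: eq_imagel => x _; congr (`|_|%:E).
rewrite /boundary_estimator /c /psi; case: leP => xa /=.
  by rewrite big1// mulr0 addr0.
case: leP => bx; first by rewrite big1// mulr0 addr0.
by rewrite sub0r addrC.
Qed.

Lemma sup_norm_error_le n w D omega S Sloc M : (0 < n)%N ->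
  (forall x y, a <= x <= b -> a <= y <= b -> `|y - x| <= 2 * h n ->
    `|F y - F x - D x * (y - x)| <= omega) ->
  (forall alpha, 0 < alpha < 1 ->
    D a * (alpha * (1 - moment KL 0 alpha) + moment KL 1 alpha) = 0 /\
    D b * (alpha * (1 - moment KL 0 alpha) + moment KL 1 alpha) = 0) ->
  (forall t, `|deviation X `]-oo, t] (F t) n w| <= S * n%:R) ->
  (forall t, t <= a + 2 * h n \/ b - 2 * h n <= t ->
    `|deviation X `]-oo, t] (F t) n w| <= Sloc * n%:R) ->
  S <= M -> C * Sloc <= M ->
  (sup_norm (fun x => Ftilde n w x - F x)%R <= (M + (C + 1) * omega)%:E)%E.
Proof.
move=> n0 FD Dm hS hSloc SM SlocM; apply: sup_norm_le.
have np : 0 < n%:R :> R by rewrite ltr0n.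
apply: (boundary_estimator_error ab K_kernel KL_kernel KL_C F_left F_right n0
  (h_range n0) FD Dm _ _ SM SlocM) => t.
  by rewrite empirical_deviationE// ler_pdivrMr.
by move=> /hSloc; rewrite empirical_deviationE// ler_pdivrMr.
Qed.

Lemma almost_complete_consistency :
  cvg_almost_completely0 P (fun n w => sup_norm (fun x => Ftilde n w x - F x)).
Proof.
split=> [n n0|e e0]; first exact: measurable_sup_norm_error.
(* Half of [e] goes to the stochastic part and half to the bias [(C + 1) * c]. The same [c] serves
   near the boundary, where [C * c <= e / 2]. *)
pose c := e / (2 * (C + 1)).
have C1 : 0 < C + 1 by rewrite ltr_wpDl.
have c0 : 0 < c by rewrite divr_gt0// mulr_gt0.
have cE : (C + 1) * c = e / 2 by rewrite /c; field; rewrite gt_eqF.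
have [E [mE sumE hE]] :=
  uniform_deviation_summable X_indep F_nondecreasing F01 mF PF c0.
have [r r0 hr] := F_unif c0.
have [n0 hn0] := h_lt r0.
pose u n := P [set w | (e%:E < `|sup_norm (fun x => (Ftilde n w x - F x)%R)|)%E].
have mset n : (0 < n)%N -> measurable
    [set w | (e%:E < `|sup_norm (fun x => (Ftilde n w x - F x)%R)|)%E].
  move=> n_gt0; rewrite -[X in measurable X]setTI.
  apply: emeasurable_fun_o_infty => //.
  by apply: measurableT_comp => //; exact: measurable_sup_norm_error.
apply: (@nneseries_lty_le _ u (fun n => P (E n)) 1 n0) => //.
  move=> n n_gt0; rewrite measure_ge0/=; apply: le_lt_trans (ltry 1).
  by apply: probability_le1; exact: mset.
case=> // n _ hn; apply: le_measure; rewrite ?inE//; first exact: mset.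
move=> w /= hw; apply: contrapT => nE.
have np : 0 < n.+1%:R :> R by [].
have : (sup_norm (fun x => Ftilde n.+1 w x - F x)%R <= (e / 2 + (C + 1) * c)%:E)%E.
  apply: (@sup_norm_error_le n.+1 w (fun=> 0) c c c (e / 2)) => //.
  - move=> x y _ _ xy; rewrite mul0r subr0; apply/ltW/hr.
    by apply: le_lt_trans xy (hn0 _ hn _).
  - by move=> alpha _; rewrite !mul0r.
  - by move=> t; exact: hE.
  - by move=> t _; exact: hE.
  - by rewrite -cE ler_peMl ?(ltW c0)// lerDr.
  - by rewrite -cE ler_wpM2r ?(ltW c0)// lerDl.
rewrite cE (_ : e / 2 + e / 2 = e); last by field.
move: hw; rewrite gee0_abs; first by move=> /lt_le_trans h1 /h1; rewrite ltxx.
apply: (@le_trans _ _ `|Ftilde n.+1 w 0 - F 0|%:E); first by rewrite lee_fin.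
by apply: ereal_sup_ubound; exists 0.
Qed.

(** Common core of both Chung-Smirnov statements, which differ only in the choice of [D] and in the
    order of the bias [omega]. *)
Lemma Chung_Smirnov_of_remainder (D : R -> R) (omega : nat -> R) :
  (forall n, (0 < n)%N -> forall x y, a <= x <= b -> a <= y <= b ->
    `|y - x| <= 2 * h n -> `|F y - F x - D x * (y - x)| <= omega n) ->
  (forall alpha, 0 < alpha < 1 ->
    D a * (alpha * (1 - moment KL 0 alpha) + moment KL 1 alpha) = 0 /\
    D b * (alpha * (1 - moment KL 0 alpha) + moment KL 1 alpha) = 0) ->
  Num.sqrt (n%:R / ln (ln n%:R)) * omega n @[n --> \oo] --> (0 : R) ->
  Chung_Smirnov P (fun n w => Ftilde n w) F.
Proof.
move=> FD Dm omega0.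
have C1 : 0 < C + 1 by rewrite ltr_wpDl.
(* [C * e j <= 1] keeps the boundary term below the interior one. A sequence tending to 0 is used so
   that only countably many null sets are discarded. *)
pose e (j : nat) : R := j.+1%:R^-1 / (C + 1).
have e01 j : 0 < e j <= 1.
  rewrite divr_gt0//= ler_pdivrMr// mul1r.
  by apply: (@le_trans _ _ 1); [rewrite invf_le1// ler1n|rewrite lerDr].
have /ae_foralln : forall j, \forall w \ae P, exists2 delta, 0 < delta &
    exists n0 : nat, forall n t, (n0 <= n)%N ->
    let sigma := Num.sqrt (n%:R * ln (ln n%:R) / 2) in
    `|deviation X `]-oo, t] (F t) n w| <= (1 + e j) * sigma /\
    (F t < delta \/ 1 - delta < F t ->
     `|deviation X `]-oo, t] (F t) n w| <= e j * sigma).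
  move=> j; have [delta delta0] :=
    law_iterated_logarithm X_indep F_nondecreasing F01 mF PF (e01 j).
  by apply: filterS => w hw; exists delta.
apply: filterS => w hw.
apply/lee_addgt0Pr => eps eps0; apply: limn_esup_le_near.
have [j hj] : exists j : nat, e j <= eps / 2.
  have [j hj] := ltr_add_invr (divr_gt0 eps0 (ltr0n R 2) : 0 < eps / 2).
  exists j; rewrite add0r in hj; apply: le_trans (ltW hj).
  by rewrite /e ler_pdivrMr// ler_peMr ?invr_ge0// lerDr.
have [delta delta0 [n0 hn0]] := hw j.
(* From some [n] on, the strips of width [2 h n] at the two ends lie where [F < delta] or
   [F > 1 - delta], so the small bound holds on them. *)
have [r r0 hr] := F_unif delta0.
have [n1 hn1] := h_lt r0.
have [n2 hn2] : exists n2 : nat, forall n, (n2 <= n)%N -> 1 <= ln (ln (n%:R : R)).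
  exists (Num.truncn (expR (expR 1 : R))).+1 => n hn.
  have hn' : expR (expR 1) < n%:R :> R by rewrite -truncn_lt_nat ?expR_ge0.
  have np : 0 < n%:R :> R by apply: le_lt_trans hn'; exact: expR_ge0.
  have h2 : expR 1 <= ln n%:R :> R by rewrite -ler_expR lnK ?posrE// ltW.
  by rewrite -ler_expR lnK ?posrE// (lt_le_trans _ h2)// expR_gt0.
have eta0 : 0 < eps / (4 * (C + 1)) by rewrite divr_gt0// mulr_gt0.
have /cvgrPdist_lt/(_ _ eta0)[n3 _ hn3] := omega0.
exists (maxn 1 (maxn (maxn n0 n1) (maxn n2 n3))) => // n /=.
rewrite !geq_max => /and3P[n_gt0 /andP[/hn0 hsig /hn1 hh] /andP[/hn2 hln /hn3 hom]].
have np : 0 < n%:R :> R by rewrite ltr0n.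
set LL : R := ln (ln n%:R) in hsig hln hom *.
have LL0 : 0 < LL by exact: lt_le_trans hln.
pose sigma : R := Num.sqrt (n%:R * LL / 2).
pose A : R := Num.sqrt (2 * n%:R / LL).
have A0 : 0 <= A by exact: sqrtr_ge0.
(* The normalization turns [sigma / n] into exactly 1: the origin of the constant in the
   conclusion. *)
have Asigma : A * (sigma / n%:R) = 1.
  rewrite mulrA /A /sigma -sqrtrM; last by rewrite divr_ge0 ?(ltW LL0)// mulr_ge0.
  rewrite (_ : _ * (_ / 2) = n%:R ^+ 2); last by rewrite expr2; field; rewrite gt_eqF.
  by rewrite sqrtr_sqr ger0_norm// divff// gt_eqF.
have Aomega : A * ((C + 1) * omega n) <= eps / 2.
  have AE : A = Num.sqrt 2 * Num.sqrt (n%:R / LL) by rewrite /A -mulrA sqrtrM.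
  have s2 : Num.sqrt 2 <= 2 :> R.
    by rewrite -[leRHS](@ger0_norm _ 2)// -sqrtr_sqr ler_wsqrtr// expr2; lra.
  have := hom; rewrite /= sub0r normrN => /ltW.
  move=> /(le_trans (ler_norm _)) hom'.
  have -> : A * ((C + 1) * omega n) =
      Num.sqrt 2 * ((C + 1) * (Num.sqrt (n%:R / LL) * omega n)) by rewrite AE; ring.
  apply: (@le_trans _ _ (Num.sqrt 2 * ((C + 1) * (eps / (4 * (C + 1)))))).
    by rewrite ler_wpM2l ?sqrtr_ge0// ler_wpM2l// ltW.
  rewrite (_ : (C + 1) * _ = eps / 4); last by field; rewrite gt_eqF.
  have e4 : 0 <= eps / 4 by rewrite divr_ge0// ltW.
  have := ler_wpM2r e4 s2; lra.
have hb := h_range n_gt0.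
have sb : (sup_norm (fun x => Ftilde n w x - F x)%R <=
    ((1 + e j) * (sigma / n%:R) + (C + 1) * omega n)%:E)%E.
  apply: (@sup_norm_error_le n w D _ ((1 + e j) * (sigma / n%:R)) (e j * (sigma / n%:R))) => //.
  - exact: FD.
  - by move=> t; rewrite -!mulrA mulVf ?gt_eqF// mulr1; have [] := hsig t.
  - move=> t ht; rewrite -mulrA divfK ?gt_eqF//; have [_ hs] := hsig t.
    apply: hs.
    have hh' := hh n_gt0; case: ht => ht; [left|right].
      apply: (@le_lt_trans _ _ (F (a + 2 * h n))); first exact: F_nondecreasing.
      rewrite -[F _]subr0 -(F_left (lexx a)); apply: le_lt_trans (ler_norm _) _.
      by apply: hr; rewrite addrAC subrr add0r ger0_norm//; lra.
    apply: (@lt_le_trans _ _ (F (b - 2 * h n))); last exact: F_nondecreasing.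
    have := hr b (b - 2 * h n); rewrite addrAC subrr add0r normrN ger0_norm; last by lra.
    by move=> /(_ hh'); rewrite (F_right (lexx b)) ltr_norml; lra.
  - have sn0 : 0 <= sigma / n%:R by rewrite divr_ge0 ?sqrtr_ge0// ltW.
    rewrite mulrA ler_wpM2r//; have /andP[ej0 _] := e01 j.
    have : C * e j <= 1.
      rewrite /e mulrCA; apply: (@le_trans _ _ (j.+1%:R^-1 * 1)).
        by rewrite ler_wpM2l ?invr_ge0// ler_pdivrMr// mul1r lerDl.
      by rewrite mulr1 invf_le1// ler1n.
    lra.
apply: (@le_trans _ _ (A%:E * ((1 + e j) * (sigma / n%:R) + (C + 1) * omega n)%:E)%E).
  by rewrite lee_wpmul2l// lee_fin.
rewrite -EFinM lee_fin mulrDr.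
rewrite (mulrCA A) Asigma mulr1; lra.
Qed.

End consistency.

Lemma lipschitz_within_itvP {R : realType} (g : R -> R) (a b : R) :
  [lipschitz g x | x in `[a, b]] -> exists2 L, 0 <= L &
  forall x y, a <= x <= b -> a <= y <= b -> `|g x - g y| <= L * `|x - y|.
Proof.
move=> gL; near (pinfty_nbhs R) => L.
exists L; first by near: L; exact: nbhs_pinfty_ge.
move=> x y xab yab; have : L.-lipschitz_on (fun x => g x) (globally (`[a, b] `*` `[a, b])).
  by near: L.
by move=> /(_ (x, y)); apply; split; rewrite /= in_itv.
Unshelve. all: by end_near. Qed.

Theorem theorem3 (R : realType) (d : measure_display) (T : measurableType d)
  (P : probability T R) (X : nat -> {RV P >-> R}) (f : R -> R) (a b : R)
  (K : R -> R) (KL : R -> R -> R) (h : nat -> R)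
  (ab : a < b)
  (X_indep : mutually_independent X)
  (X_density : forall i, has_density (X i) f)
  (f_support : closed_support f = `[a, b]%classic)
  (K_kernel : kernel_density K)
  (KL_kernel : left_boundary_kernel KL)
  (h_range : forall n, (0 < n)%N -> 0 < h n <= (b - a) / 2)
  (h_cvg0 : h n @[n --> \oo] --> (0 : R))
  (KL_bounded :
    (ereal_sup [set abs_moment0 KL alpha | alpha in `]0%R, 1%R[%classic] < +oo)%E) :
  let F : R -> R := distribution_function (X 0%N) in
  let Ftilde (n : nat) (w : T) : R -> R :=
    boundary_estimator a b K KL (h n) n (fun i => X i w) in
  [/\ cvg_almost_completely0 P
        (fun n w => sup_norm (fun x => Ftilde n w x - F x)),
      [lipschitz F x | x in `[a, b]] ->
      Num.sqrt (n%:R / ln (ln n%:R)) * h n @[n --> \oo] --> (0 : R) ->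
      Chung_Smirnov P Ftilde F &
      forall F' : R -> R,
      (forall x, a <= x <= b -> has_derivative_within `[a, b] F x (F' x)) ->
      [lipschitz F' x | x in `[a, b]] ->
      (forall alpha, 0 < alpha < 1 ->
        alpha * (1 - moment KL 0 alpha) + moment KL 1 alpha = 0) ->
      Num.sqrt (n%:R / ln (ln n%:R)) * h n ^+ 2 @[n --> \oo] --> (0 : R) ->
      Chung_Smirnov P Ftilde F].

Proof.
have [C C0 KL_C] : exists2 C : R, 0 <= C & forall alpha, 0 < alpha < 1 ->
    \int[@lebesgue_measure R]_v `|KL alpha v| <= C.
  pose s := ereal_sup [set abs_moment0 KL alpha | alpha in `]0%R, 1%R[%classic].
  have les alpha : 0 < alpha < 1 -> (abs_moment0 KL alpha <= s)%E.
    by move=> al; apply: ereal_sup_ubound; exists alpha => //=; rewrite in_itv.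
  have m0 alpha : (0 <= abs_moment0 KL alpha)%E by exact: integral_ge0.
  have s0 : (0 <= s)%E by apply: (le_trans (m0 (1 / 2))); apply: les; lra.
  have sfin : s \is a fin_num by rewrite ge0_fin_numE.
  exists (fine s); first exact: fine_ge0.
  move=> alpha al; rewrite /Rintegral fine_le ?les//.
  by rewrite ge0_fin_numE ?m0// (le_lt_trans (les _ al)).
move=> F Ftilde; split.
- exact: (almost_complete_consistency ab X_indep X_density f_support K_kernel
    KL_kernel h_range h_cvg0 C0 KL_C).
- move=> /lipschitz_within_itvP[L L0 FL] nh0.
  (* With [D = 0] the remainder is the increment of [F] itself, over distances of at most
     [2 h n]. *)
  apply: (Chung_Smirnov_of_remainder ab X_indep X_density f_support K_kernel
    KL_kernel h_range h_cvg0 C0 KL_C (D := fun=> 0) (omega := fun n => L * (2 * h n))).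
  + move=> n n0 x y xab yab xy; rewrite mul0r subr0.
    by apply: (le_trans (FL _ _ yab xab)); rewrite ler_wpM2l.
  + by move=> alpha _; rewrite !mul0r.
  rewrite (_ : (fun _ => _) =
      (fun n => 2 * L * (Num.sqrt (n%:R / ln (ln n%:R)) * h n))).
    by rewrite -[X in _ --> X](mulr0 (2 * L)); apply: cvgM => //; exact: cvg_cst.
  by apply/funext => n; ring.
move=> F' dF /lipschitz_within_itvP[L L0 FL] KLmom nh0.
have Fcont : continuous F.
  exact: distribution_function_continuous (X_density 0).
apply: (Chung_Smirnov_of_remainder ab X_indep X_density f_support K_kernel
  KL_kernel h_range h_cvg0 C0 KL_C (D := F') (omega := fun n => L * (2 * h n) ^+ 2)).
- move=> n n0 x y xab yab xy.
  have tr := taylor_remainder dF Fcont FL xab yab; apply: (le_trans tr).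
  have /andP[hn _] := h_range n n0.
  by rewrite ler_wpM2l// lerXn2r ?nnegrE// mulr_ge0// ltW.
- by move=> alpha al; rewrite KLmom// !mulr0.
rewrite (_ : (fun _ => _) =
    (fun n => 4 * L * (Num.sqrt (n%:R / ln (ln n%:R)) * h n ^+ 2))).
  by rewrite -[X in _ --> X](mulr0 (4 * L)); apply: cvgM => //; exact: cvg_cst.
by apply/funext => n; rewrite exprMn; ring.
Qed.
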